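(* Let $\rho\in(0,1]$ be such that $\rho^2$ is irrational or $\rho=1$, and let $\mathbb{T}^2_\rho=(\mathbb{R}/2\pi\mathbb{Z})\times(\mathbb{R}/2\rho\pi\mathbb{Z})$ be the flat torus. Then any non-constant eigenfunction $u$ of the Laplace-Beltrami operator $-\Delta$ on $\mathbb{T}^2_\rho$ has an even number of nodal domains. More precisely, the nodal domains of $u$ can be divided into pairs of isometric domains, $u$ being positive on one domain of each pair and negative on the other.
   Context: For $\rho\in(0,1]$, the torus $\mathbb{T}^2_\rho=(\mathbb{R}/2\pi\mathbb{Z})\times(\mathbb{R}/2\rho\pi\mathbb{Z})$ is viewed as a two-dimensional Riemannian manifold with the flat metric, and $-\Delta$ is its non-negative Laplace-Beltrami operator. Eigenfunctions are real-valued (and not identically zero). The eigenvalues are $\lambda_{m,n}=m^2+\frac{n^2}{\rho^2}$ with $m,n$ non-negative integers, and the eigenspace of an eigenvalue $\lambda$ is spanned by the non-zero functions among $\cos(mx_1)\cos(nx_2/\rho)$, $\cos(mx_1)\sin(nx_2/\rho)$, $\sin(mx_1)\cos(nx_2/\rho)$, $\sin(mx_1)\sin(nx_2/\rho)$, over all pairs $(m,n)$ of non-negative integers with $\lambda=m^2+\frac{n^2}{\rho^2}$. For an eigenfunction $u$, the nodal set is the closed set $\mathcal{N}(u)=u^{-1}(\{0\})$, and a nodal domain of $u$ is a connected component of $\mathbb{T}^2_\rho\setminus\mathcal{N}(u)$. *)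

(* Defs.v *)
From HB Require Import structures.
From mathcomp Require Import all_boot all_order all_algebra.
From mathcomp Require Import all_classical all_reals all_analysis.

Set Implicit Arguments.
Unset Strict Implicit.
Unset Printing Implicit Defensive.

Import Order.TTheory GRing.Theory Num.Theory.
Import numFieldNormedType.Exports.

Local Open Scope classical_set_scope.
Local Open Scope ring_scope.

Section Torus.
Variable R : realType.

Definition period_rel (l : R) : rel R :=
  fun x y => `[< exists k : int, y - x = k%:~R * l >].

Lemma period_rel_equiv (l : R) : equiv_class_of (period_rel l).
Proof.
split.
- by move=> x; apply/asboolP; exists 0; rewrite subrr mul0r.
- have sym x y : period_rel l x y -> period_rel l y x.
    move=> /asboolP[k xy]; apply/asboolP; exists (- k).
    by rewrite mulrNz mulNr -xy opprB.
  by move=> x y; apply/idP/idP; exact: sym.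
- move=> y x z /asboolP[k xy] /asboolP[m yz]; apply/asboolP.
  by exists (m + k); rewrite mulrzDr mulrDl -xy -yz addrA subrK.
Qed.

Canonical period_equiv (l : R) := EquivRelPack (period_rel_equiv l).

(* The circle R / lZ of length l, with the quotient topology. *)
Definition circle (l : R) : topologicalType :=
  quotient_topology {eq_quot (period_equiv l)}%qT.

Definition circle_proj (l : R) (x : R) : circle l :=
  \pi_(quotient_topology {eq_quot (period_equiv l)}%qT)%qT x.

Definition torus (rho : R) : topologicalType :=
  (circle (2 * pi) * circle (2 * rho * pi))%type.

(* The covering map R^2 -> T^2_rho. Its local inverses are the charts of the
   torus, and the flat metric is the one which makes it a local isometry:
   differential notions on the torus are read off through it. *)
Definition torus_proj (rho : R) (x : R * R) : torus rho :=
  (circle_proj (2 * pi) x.1, circle_proj (2 * rho * pi) x.2).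

Fixpoint class_C (k : nat) (W : normedModType R) (A : set (R * R)%type)
    (f : R * R -> W) : Prop :=
  match k with
  | 0 => forall x, A x -> {for x, continuous f}
  | k'.+1 => (forall x, A x -> differentiable f x) /\
             (forall v : R * R, class_C k' A ('D_v f))
  end.

Definition smooth (W : normedModType R) (A : set (R * R)%type)
  (f : R * R -> W) : Prop := forall k, class_C k A f.

Definition laplacian (f : R * R -> R) (x : R * R) : R :=
  'D_((1, 0) : R * R) ('D_((1, 0) : R * R) f) x +
  'D_((0, 1) : R * R) ('D_((0, 1) : R * R) f) x.

(* Since [torus_proj] is a local isometry, the Laplace-Beltrami operator of the
   torus is the Euclidean Laplacian of the lift to the plane. *)
Definition eigenfunction (rho : R) (u : torus rho -> R) : Prop :=
  [/\ exists p, u p != 0,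
      class_C 2 setT (u \o @torus_proj rho) &
      exists lambda : R, forall x : R * R,
        - laplacian (u \o @torus_proj rho) x = lambda * u (torus_proj rho x)].

Definition nodal_set (rho : R) (u : torus rho -> R) : set (torus rho) :=
  u @^-1` [set 0].

Definition nodal_domains (rho : R) (u : torus rho -> R) :
    set (set (torus rho)) :=
  connected_component (~` nodal_set u) @` (~` nodal_set u).

(* The Euclidean inner product; the library's norm on [R * R] is the sup norm. *)
Definition dot2 (v w : R * R) : R := v.1 * w.1 + v.2 * w.2.

(* [f] is smooth and preserves the flat metric on the open set [D]: near each
   point of [D] it lifts to a smooth map [F] between open subsets of the plane
   whose differentials preserve the Euclidean inner product. *)
Definition local_isometry (rho : R) (D : set (torus rho))
    (f : torus rho -> torus rho) : Prop :=
  forall x : R * R, D (torus_proj rho x) ->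
  exists (U : set (R * R)%type) (F : R * R -> R * R),
    [/\ open U, U x, smooth U F,
        forall y, U y -> torus_proj rho (F y) = f (torus_proj rho y) &
        forall y, U y -> forall v w, dot2 ('d F y v) ('d F y w) = dot2 v w].

(* Isometric as open Riemannian submanifolds of the flat torus: some
   diffeomorphism from [D] to [E], with inverse [g], preserves the metric. The
   values of [f] outside [D] and of [g] outside [E] are irrelevant. *)
Definition isometric (rho : R) (D E : set (torus rho)) : Prop :=
  exists f g : torus rho -> torus rho,
    [/\ (forall p, D p -> E (f p) /\ g (f p) = p),
        (forall q, E q -> D (g q) /\ f (g q) = q),
        local_isometry D f & local_isometry E g].

End Torus.

(* Main.v *)
(** A translation [sigma] of the torus satisfies [u o sigma = - u].  Expanding
    [u] in Fourier series, only the modes [(m, n)] with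
    [m^2 + n^2 / rho^2 = lambda] occur; a common half period of these modes is
    found by uniqueness of [(m, n)] when [rho^2] is irrational, and by descent on
    the powers of 4 dividing [m^2 + n^2] when [rho = 1].  So [sigma] exchanges the
    positive and the negative nodal domains isometrically.

    There are finitely many nodal domains because, by the maximum principle, none
    of them fits in a thin vertical strip: each meets one of finitely many
    vertical circles, on which [u] is a trigonometric polynomial and therefore
    vanishes identically or has finitely many zeros. *)

Require Import Defs.
From HB Require Import structures.
From mathcomp Require Import all_boot all_order all_algebra.
From mathcomp Require Import all_classical all_reals all_analysis.
From mathcomp Require Import ring lra zify.
Import Order.TTheory GRing.Theory Num.Theory.
Import numFieldNormedType.Exports.
Local Open Scope classical_set_scope.
Local Open Scope ring_scope.
Set Implicit Arguments.
Unset Strict Implicit.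
Unset Printing Implicit Defensive.

(** * Integration over a period *)

(** Only a [C^2] lift and some real [lambda] are given, so the finite expansion has to be derived.
    At a fixed height [y], a Fourier coefficient in [x] is a function of [y], and the eigenvalue
    equation makes it a periodic solution of a harmonic oscillator, that is, a single frequency or
    zero. No series ever has to converge: it is enough that a continuous periodic function with
    vanishing coefficients is zero.

    A translation acts on a mode by a sign. The difficulty is to obtain the sign -1 on all modes of
    one eigenvalue at once, since several pairs may share it.

    The translation alone yields pairs, but an even cardinal presupposes finiteness. Courant's bound
    would need the min-max principle; a pointwise comparison in strips avoids it. Strips suit the
    task because a domain may wind around the torus vertically: its lift is then unbounded in [y],
    and vertical periodicity restores the compactness that the maximum principle requires. *)

Section real_functions.
Variable R : realType.
Implicit Types (f g h F : R -> R) (x y a b c : R).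

Lemma cont_cst c : continuous (fun _ : R => c).
Proof. by move=> x; exact: cvg_cst. Qed.

Lemma contD f g : continuous f -> continuous g -> continuous (fun x => f x + g x).
Proof. by move=> cf cg x; apply: cvgD; [exact: cf|exact: cg]. Qed.

Lemma contM f g : continuous f -> continuous g -> continuous (fun x => f x * g x).
Proof. by move=> cf cg x; apply: cvgM; [exact: cf|exact: cg]. Qed.

Lemma contB f g : continuous f -> continuous g -> continuous (fun x => f x - g x).
Proof. by move=> cf cg x; apply: cvgB; [exact: cf|exact: cg]. Qed.

Lemma cont_comp f g : continuous f -> continuous g -> continuous (fun x => f (g x)).
Proof. by move=> cf cg x; apply: (@continuous_comp _ _ _ g f) => //; [exact: cg|exact: cf]. Qed.

Lemma cont_sum (I : Type) (r : seq I) (G : I -> R -> R) :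
  (forall i, continuous (G i)) -> continuous (fun x => \sum_(i <- r) G i x).
Proof.
move=> cG; elim: r => [|i r IH].
  under [X in continuous X]eq_fun do rewrite big_nil; exact: cont_cst.
under [X in continuous X]eq_fun do rewrite big_cons; exact: contD.
Qed.

Lemma is_derive1_cont f (df : R -> R) :
  (forall x, is_derive x 1 f (df x)) -> continuous f.
Proof.
by move=> fd x; apply/differentiable_continuous/derivable1_diffP; case: (fd x).
Qed.

Lemma is_derive1D f g x a b : is_derive x 1 f a -> is_derive x 1 g b ->
  is_derive x 1 (fun t => f t + g t) (a + b).
Proof. by move=> fa gb; exact: is_deriveD. Qed.

Lemma is_derive1M f g x a b : is_derive x 1 f a -> is_derive x 1 g b ->
  is_derive x 1 (fun t => f t * g t) (a * g x + f x * b).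
Proof.
move=> fa gb; apply: (is_derive_eq (is_deriveM fa gb)).
by rewrite addrC [X in _ = X + _]mulrC.
Qed.

Lemma is_derive1Z c f x a : is_derive x 1 f a ->
  is_derive x 1 (fun t => c * f t) (c * a).
Proof. by move=> fa; exact: is_deriveZ. Qed.

Lemma is_derive1_scale f x a c : is_derive (c * x) 1 f a ->
  is_derive x 1 (fun t => f (c * t)) (c * a).
Proof.
move=> fa; rewrite mulrC; apply: (@is_derive1_comp _ f (fun t => c * t)) => //.
rewrite -[X in is_derive _ _ _ X]mulr1; apply: is_derive1Z; exact: is_derive_id.
Qed.

Lemma is_derive1_shift f x a c : is_derive (x + c) 1 f a ->
  is_derive x 1 (fun t => f (t + c)) a.
Proof.
move=> fa; rewrite -[a]mulr1; apply: (@is_derive1_comp _ f (fun t => t + c)) => //.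
rewrite -[X in is_derive _ _ _ X]addr0.
exact: is_derive1D.
Qed.

(** A weak Bernoulli inequality: linear growth in [n] is already enough to contradict a bound
    independent of [n] in [orth_le0]. *)
Lemma natr_mulB1_le_expr x n : 1 <= x -> n%:R * (x - 1) <= x ^+ n.
Proof.
move=> x1; elim: n => [|n IH]; first by rewrite mul0r expr0.
have xn1 : 1 <= x ^+ n by rewrite exprn_ege1.
rewrite exprS -natr1; nra.
Qed.

Definition circle_int f : R := \int[lebesgue_measure]_(x in `[0, 2 * pi]) f x.

Lemma twopi_gt0 : 0 < 2 * pi :> R.
Proof. by rewrite mulr_gt0 // pi_gt0. Qed.

Lemma itv_integrable f a b : continuous f ->
  lebesgue_measure.-integrable `[a, b] (EFin \o f).
Proof.
move=> cf; apply: continuous_compact_integrable; first exact: segment_compact.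
exact: continuous_subspaceT.
Qed.

Lemma circle_int_ext f g : f =1 g -> circle_int f = circle_int g.
Proof. by move=> fg; apply: eq_Rintegral => x _; exact: fg. Qed.

Lemma circle_intD f g : continuous f -> continuous g ->
  circle_int (fun x => f x + g x) = circle_int f + circle_int g.
Proof. by move=> cf cg; apply: RintegralD => //; exact: itv_integrable. Qed.

Lemma circle_intZ c f : continuous f ->
  circle_int (fun x => c * f x) = c * circle_int f.
Proof. by move=> cf; apply: RintegralZl => //; exact: itv_integrable. Qed.

Lemma circle_int0 : circle_int (fun _ => 0) = 0.
Proof. by rewrite /circle_int Rintegral_cst // mul0r. Qed.

Lemma circle_int_sum (I : Type) (r : seq I) (G : I -> R -> R) :
  (forall i, continuous (G i)) ->
  circle_int (fun x => \sum_(i <- r) G i x) = \sum_(i <- r) circle_int (G i).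
Proof.
move=> cG; elim: r => [|i r IH].
  rewrite big_nil -[RHS]circle_int0; apply: circle_int_ext => x.
  by rewrite big_nil.
rewrite big_cons -IH -circle_intD //; last exact: cont_sum.
by apply: circle_int_ext => x; rewrite big_cons.
Qed.

Lemma circle_int_le f g : continuous f -> continuous g ->
  (forall x, 0 <= x <= 2 * pi -> f x <= g x) -> circle_int f <= circle_int g.
Proof.
move=> cf cg fg; apply: le_Rintegral => //; [exact: itv_integrable|exact: itv_integrable].
Qed.

Lemma circle_int_FTC F f : continuous f -> (forall x, is_derive x 1 F (f x)) ->
  circle_int f = F (2 * pi) - F 0.
Proof.
move=> cf Ff; rewrite /circle_int /Rintegral.
have cF := is_derive1_cont Ff.
rewrite (@continuous_FTC2 _ f F) ?twopi_gt0 //.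
- exact: continuous_subspaceT.
- split.
  + by move=> x _; case: (Ff x).
  + by apply: cvg_at_right_filter; exact: cF.
  + by apply: cvg_at_left_filter; exact: cF.
- by move=> x _; rewrite derive1E; case: (Ff x).
Qed.

Lemma circle_int_gt0 h x : continuous h -> (forall y, 0 <= h y) ->
  0 < x < 2 * pi -> 0 < h x -> 0 < circle_int h.
Proof.
move=> ch h0 x02 hx.
have hx2 : 0 < h x / 2 by rewrite divr_gt0.
have /cvgrPdist_lt /(_ _ hx2) := ch x.
move=> /nbhs_ballP [e /= e0 he].
pose r := Num.min (e / 2) (Num.min x (2 * pi - x)).
have r0 : 0 < r.
  by rewrite !lt_min divr_gt0 //=; lra.
have [re rx rpi] : [/\ r <= e / 2, r <= x & r <= 2 * pi - x].
  by split; rewrite /r !ge_min lexx ?orbT.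
have sub : `[x - r, x + r] `<=` `[0, 2 * pi].
  by move=> y /=; rewrite !in_itv /=; lra.
apply: (@lt_le_trans _ _ (h x / 2 * (2 * r))); first by rewrite !mulr_gt0.
apply: (@le_trans _ _ (\int[lebesgue_measure]_(y in `[x - r, x + r]) (h x / 2))).
  rewrite Rintegral_cst //= lebesgue_measure_itv /= lte_fin ifT; last by lra.
  rewrite le_eqVlt; apply/orP; left; apply/eqP; congr (_ * _).
  by rewrite /=; ring.
apply: (@le_trans _ _ (\int[lebesgue_measure]_(y in `[x - r, x + r]) (h y))).
  apply: le_Rintegral => //; [|exact: itv_integrable|].
    by apply: (@itv_integrable (fun _ => h x / 2)); exact: cont_cst.
  move=> y /=; rewrite in_itv /= => yr.
  have := he y; rewrite /ball /= => /(_ _).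
  have xy : `|x - y| < e by rewrite ltr_norml; apply/andP; split; lra.
  by move=> /(_ xy); rewrite ltr_norml; lra.
rewrite /circle_int /Rintegral; apply: fine_le.
- by apply: integrable_fin_num => //; exact: itv_integrable.
- by apply: integrable_fin_num => //; exact: itv_integrable.
- apply: ge0_subset_integral => //.
    by have /integrableP[] := itv_integrable 0 (2 * pi) ch.
  by move=> y _; rewrite lee_fin.
Qed.

Lemma continuous_bounded f : continuous f ->
  exists2 M : R, 0 < M & forall x, 0 <= x <= 2 * pi -> `|f x| <= M.
Proof.
move=> cf; have [|c _ fc] := @EVT_max R (fun x => `|f x|) 0 (2 * pi) (ltW twopi_gt0).
  by apply: continuous_subspaceT; apply: cont_comp => //; exact: norm_continuous.
exists (`|f c| + 1); first by rewrite ltr_wpDl.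
move=> x x02; have := fc x; rewrite in_itv /= => /(_ x02); lra.
Qed.

End real_functions.

(** * Fourier series *)

Section fourier.
Variable R : realType.
Implicit Types (f g h : R -> R) (x y : R) (b : bool) (m n : nat).

(** One family for sine and cosine, so that differentiation negates [b]. The member [trig true 0] is
    the zero function, the exceptional case whenever a norm appears in a denominator. *)
Definition trig b m x : R := if b then sin (m%:R * x) else cos (m%:R * x).

Definition dtrig_coef b m : R := if b then m%:R else - m%:R.

Lemma is_derive_trig b m x :
  is_derive x 1 (trig b m) (dtrig_coef b m * trig (~~ b) m x).
Proof.
case: b; rewrite /trig /dtrig_coef /=; first exact: is_derive1_scale.
rewrite mulNr -mulrN; exact: is_derive1_scale.
Qed.

Lemma dtrig_coefM b m : dtrig_coef b m * dtrig_coef (~~ b) m = - m%:R ^+ 2.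
Proof. by case: b; rewrite /dtrig_coef /= expr2 ?mulrN ?mulNr. Qed.

Lemma is_derive_dtrig b m x :
  is_derive x 1 (fun t => dtrig_coef b m * trig (~~ b) m t)
    (- m%:R ^+ 2 * trig b m x).
Proof.
rewrite -(dtrig_coefM b) -mulrA; apply: is_derive1Z.
by have := is_derive_trig (~~ b) m x; rewrite negbK.
Qed.

Lemma trig_cont b m : continuous (trig b m).
Proof. exact: (is_derive1_cont (@is_derive_trig b m)). Qed.

Lemma trig_pi_shift b m j x t : m%:R * t = j%:R * pi ->
  trig b m (x + t) = (-1) ^+ j * trig b m x.
Proof.
move=> mt; have e : m%:R * (x + t) = m%:R * x + pi *+ j.
  by rewrite mulrDr mt -[pi *+ j]mulr_natl.
rewrite /trig e; case: b.
  elim: j {mt e} => [|j IH]; first by rewrite mulr0n addr0 expr0 mul1r.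
  by rewrite mulrSr addrA sinDpi IH exprS mulN1r mulNr.
elim: j {mt e} => [|j IH]; first by rewrite mulr0n addr0 expr0 mul1r.
by rewrite mulrSr addrA cosDpi IH exprS mulN1r mulNr.
Qed.

Lemma trig_periodic b m x : trig b m (x + 2 * pi) = trig b m x.
Proof.
rewrite (@trig_pi_shift b m (2 * m)) ?natrM; last by ring.
by rewrite exprM sqrrN expr1n expr1n mul1r.
Qed.

Lemma trig_2pi b m : trig b m (2 * pi) = trig b m 0.
Proof. by rewrite -(trig_periodic b m 0) add0r. Qed.

Definition coef f b m := circle_int (fun x => f x * trig b m x).

Lemma coefD f g b m : continuous f -> continuous g ->
  coef (fun x => f x + g x) b m = coef f b m + coef g b m.
Proof.
move=> cf cg; rewrite /coef -circle_intD; try exact: contM (@trig_cont b m).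
by apply: circle_int_ext => x; rewrite mulrDl.
Qed.

Lemma coefZ f c b m : continuous f ->
  coef (fun x => c * f x) b m = c * coef f b m.
Proof.
move=> cf; rewrite /coef -circle_intZ; last exact: contM (@trig_cont b m).
by apply: circle_int_ext => x; rewrite mulrA.
Qed.

Lemma trig1M b c m : exists (u v : R) d p q,
  forall x, trig c 1 x * trig b m x = u * trig d p x + v * trig d q x.
Proof.
case: m => [|m].
  case: b.
    by exists 0, 0, c, 0, 0 => x; rewrite /trig !mul0r sin0 mulr0 add0r.
  by exists 1, 0, c, 1, 0 => x; rewrite /trig mul0r cos0 mul0r mul1r addr0 mulr1.
have ep x : m.+2%:R * x = m.+1%:R * x + x by rewrite -[m.+2%:R]natr1; ring.
have em x : m%:R * x = m.+1%:R * x - x by rewrite -[m.+1%:R]natr1; ring.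
exists (if b && c then - 2^-1 else 2^-1), (if c && ~~ b then - 2^-1 else 2^-1).
exists (b (+) c), m.+2, m => x.
rewrite /trig !ep !em mul1r.
by case: b; case: c => /=; rewrite ?(sinB, cosB) ?(sinD, cosD); field.
Qed.

Definition orth f := continuous f /\ forall b m, coef f b m = 0.

Lemma orthD f g : orth f -> orth g -> orth (fun x => f x + g x).
Proof.
move=> [cf f0] [cg g0]; split; first exact: contD.
by move=> b m; rewrite coefD // f0 g0 addr0.
Qed.

Lemma orthZ f c : orth f -> orth (fun x => c * f x).
Proof.
move=> [cf f0]; split; first by apply: contM => //; exact: cont_cst.
by move=> b m; rewrite coefZ // f0 mulr0.
Qed.

(** Product-to-sum formulas turn a factor of frequency 1 into neighbouring frequencies, where the
    coefficients vanish too. Iterated, this makes [f] orthogonal to all powers of [bump]. *)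
Lemma orthM f c : orth f -> orth (fun x => f x * trig c 1 x).
Proof.
move=> [cf f0]; split; first exact: contM (@trig_cont _ _).
move=> b m; have [u [v [d [p [q e]]]]] := trig1M b c m.
have cft d' p' : continuous (fun x => f x * trig d' p' x).
  exact: contM (@trig_cont _ _).
transitivity (circle_int (fun x => u * (f x * trig d p x) + v * (f x * trig d q x))).
  by apply: circle_int_ext => x; rewrite -mulrA e; ring.
rewrite circle_intD; try by apply: contM => //; exact: cont_cst.
by rewrite !circle_intZ // -/(coef _ _ _) -/(coef f d q) !f0 !mulr0 addr0.
Qed.

(** The classical peaked trigonometric polynomial of uniqueness proofs for Fourier coefficients: for
    [0 < d <= pi] it exceeds 1 exactly at distance less than [d] from [x0] modulo the period. *)
Definition bump (x0 d x : R) := 1 + cos (x - x0) - cos d.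

Lemma orth_bump f x0 d n : orth f -> orth (fun x => f x * bump x0 d x ^+ n).
Proof.
move=> of_; elim: n => [|n IH].
  by under [X in orth X]eq_fun do rewrite expr0 mulr1.
have e x : f x * bump x0 d x ^+ n.+1 =
  (1 - cos d) * (f x * bump x0 d x ^+ n) +
  (cos x0 * (f x * bump x0 d x ^+ n * trig false 1 x) +
   sin x0 * (f x * bump x0 d x ^+ n * trig true 1 x)).
  rewrite exprS /trig /= !mul1r [X in f x * (X * _)]/bump cosB; ring.
under [X in orth X]eq_fun do rewrite e.
by apply: orthD; [exact: orthZ|apply: orthD; apply: orthZ; exact: orthM].
Qed.

Lemma bump_cont x0 d : continuous (bump x0 d).
Proof.
apply: contB; last exact: cont_cst.
apply: contD; first exact: cont_cst.
apply: cont_comp; first exact: continuous_cos.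
by apply: contB; [move=> x; exact: cvg_id|exact: cont_cst].
Qed.

Lemma bump_ge1 x0 d x : 0 < d <= pi -> `|x - x0| <= d -> 1 <= bump x0 d x.
Proof.
move=> d0 xd; have := normr_ge0 (x - x0).
rewrite /bump -(cos_norm (x - x0)) => t0.
suff : cos d <= cos `|x - x0| by lra.
move: xd; rewrite le_eqVlt => /orP[/eqP -> //|lt].
by apply/ltW; rewrite ltr_cos // in_itv /=; lra.
Qed.

Lemma bump_norm_le1 x0 d x : 0 < d <= pi -> d <= `|x - x0| <= 2 * pi - d ->
  `|bump x0 d x| <= 1.
Proof.
move=> d0 xd; rewrite /bump -(cos_norm (x - x0)).
set t := `|x - x0| in xd *.
have le s : d <= s <= pi -> cos s <= cos d.
  move=> /andP[]; rewrite le_eqVlt => /orP[/eqP -> //|lt spi].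
  by apply/ltW; rewrite ltr_cos // in_itv /=; lra.
have : cos t <= cos d.
  have [tpi|tpi] := leP t pi; first by apply: le; lra.
  have -> : cos t = cos (2 * pi - t).
    have -> : 2 * pi - t = - t + pi *+ 2 by rewrite mulr_natl addrC.
    by rewrite cosD2pi cosN.
  by apply: le; lra.
have := cos_geN1 t; have := cos_le1 d.
by rewrite ler_norml; lra.
Qed.

(* Test [f] against [bump ^+ n], which blows up near [x0] and stays bounded by 1
   away from it. *)
Lemma orth_le0 f x0 : orth f -> 0 < x0 < 2 * pi -> f x0 <= 0.
Proof.
move=> of_ x02; rewrite leNgt; apply/negP => fx0.
have [cf _] := of_.
have c0 : 0 < f x0 / 2 by rewrite divr_gt0.
have /cvgrPdist_lt /(_ _ c0) := cf x0.
move=> /nbhs_ballP [e /= e0 he].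
(* The bound [e / 2] keeps [f] above [f x0 / 2] on the peak. The other two keep
   [|x - x0| <= 2 * pi - d] on the whole period, so that no translated peak enters it. *)
pose d := Num.min (e / 2) (Num.min x0 (2 * pi - x0)).
have d0 : 0 < d by rewrite !lt_min divr_gt0 //=; lra.
have [de dx dpi] : [/\ d <= e / 2, d <= x0 & d <= 2 * pi - x0].
  by split; rewrite /d !ge_min lexx ?orbT.
have d0pi : 0 < d <= pi by rewrite d0; lra.
have [M M0 fM] := continuous_bounded cf.
pose k := bump x0 d.
(* [h] is [f x0 / 2] times the positive part of [k - 1], written with an absolute value to make its
   continuity immediate. *)
pose h x := f x0 / 4 * (`|k x - 1| + (k x - 1)).
have ck : continuous k by exact: bump_cont.
have ck1 : continuous (fun x => k x - 1) by apply: contB => //; exact: cont_cst.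
have ch : continuous h.
  apply: contM; first exact: cont_cst.
  apply: contD => //; apply: cont_comp => //; exact: norm_continuous.
have h0 x : 0 <= h x.
  by rewrite /h; have := ler_norm (- (k x - 1)); rewrite normrN; nra.
have hx0 : 0 < h x0.
  have cosd : cos d < 1 by rewrite -cos0 ltr_cos // in_itv /=; lra.
  rewrite /h /k /bump subrr cos0 ger0_norm; nra.
have Ih : 0 < circle_int h by exact: circle_int_gt0 hx0.
(* On the peak this is the Bernoulli bound; off the peak [h] is 0 and [|f * k ^+ n| <= M]. After
   integration the term with [f] disappears, and a large [n] gives the contradiction. *)
have key n x : 0 <= x <= 2 * pi -> n%:R * h x <= f x * k x ^+ n + M.
  move=> x2; have := fM x x2; rewrite ler_norml => fMx.
  have [xd|xd] := leP `|x - x0| d.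
    have k1 := bump_ge1 d0pi xd; rewrite -/(k x) in k1.
    have fx : f x0 / 2 <= f x.
      have xe : `|x0 - x| < e by rewrite distrC; lra.
      by have := he x xe; rewrite /= ltr_norml; lra.
    have := natr_mulB1_le_expr n k1; rewrite /h ger0_norm; last lra.
    have : 0 <= k x ^+ n by apply: exprn_ge0; lra.
    move=> kn0 kn.
    have : f x0 / 2 * k x ^+ n <= f x * k x ^+ n by rewrite ler_wpM2r.
    have : f x0 / 2 * (n%:R * (k x - 1)) <= f x0 / 2 * k x ^+ n.
      by rewrite ler_wpM2l // ltW.
    lra.
  have k1 : `|k x| <= 1.
    apply: bump_norm_le1 => //; rewrite ltW //=.
    by rewrite ler_norml; lra.
  have kx1 : k x - 1 <= 0 by move: k1; rewrite ler_norml; lra.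
  rewrite /h ler0_norm // addNr !mulr0.
  have : `|f x * k x ^+ n| <= M.
    rewrite normrM normrX.
    have : `|k x| ^+ n <= 1 by rewrite exprn_ile1.
    have := fM x x2; have := normr_ge0 (f x).
    have : 0 <= `|k x| ^+ n by rewrite exprn_ge0.
    nra.
  by rewrite ler_norml; lra.
have cmp n : n%:R * circle_int h <= circle_int (fun=> M).
  have [cfk ofk] := orth_bump x0 d n of_.
  rewrite -circle_intZ //.
  apply: (@le_trans _ _ (circle_int (fun x => f x * k x ^+ n + M))).
    apply: circle_int_le; last by move=> x; exact: key.
      by apply: contM => //; exact: cont_cst.
    by apply: contD => //; exact: cont_cst.
  rewrite circle_intD //; last exact: cont_cst.
  suff -> : circle_int (fun x => f x * k x ^+ n) = 0 by rewrite add0r.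
  rewrite -(ofk false 0%N); apply: circle_int_ext => x.
  by rewrite /trig mul0r cos0 mulr1.
have := cmp (Num.trunc (circle_int (fun=> M) / circle_int h)).+1.
have := truncnS_gt (circle_int (fun=> M) / circle_int h).
rewrite ltr_pdivrMr //; lra.
Qed.

Lemma periodic_int f (T : R) (k : int) x : (forall x, f (x + T) = f x) ->
  f (x + k%:~R * T) = f x.
Proof.
move=> fT; have nat n y : f (y + n%:R * T) = f y.
  elim: n => [|n IH]; first by rewrite mul0r addr0.
  by rewrite -natr1 mulrDl mul1r addrA fT.
case: k => n; first exact: nat.
rewrite NegzE mulrNz -(nat n.+1 (x + _)) -pmulrn.
by congr f; ring.
Qed.

Lemma reduce_mod (T x : R) : 0 < T -> exists k : int, 0 <= x + k%:~R * T < T.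
Proof.
move=> T0; exists (- Num.floor (x / T)).
have /andP[] := Num.Theory.floor_itv (x / T).
rewrite intrD mulrNz mulNr ler_pdivlMr // ltr_pdivrMr //.
by lra.
Qed.

(** [orth_le0], applied to [f] and to its opposite, reaches only interior points of the period;
    periodicity and continuity at 0 settle the rest. *)
Lemma orth_eq0 f : orth f -> (forall x, f (x + 2 * pi) = f x) ->
  forall x, f x = 0.
Proof.
move=> of_ fper x; have [cf _] := of_.
have inside y : 0 < y < 2 * pi -> f y = 0.
  move=> y02; apply/eqP; rewrite eq_le orth_le0 //=.
  have := orth_le0 (orthZ (-1) of_) y02; lra.
have [k k02] := reduce_mod x (twopi_gt0 R).
rewrite -(periodic_int k x fper); set y := x + _ in k02 *.
move: k02 => /andP[]; rewrite le_eqVlt => /orP[/eqP <- _|y0 y2]; last first.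
  by rewrite inside // y0.
apply/eqP/negP => /negP fy.
have fy0 : 0 < `|f 0| by rewrite normr_gt0.
have /cvgrPdist_lt /(_ _ fy0) := cf 0.
move=> /nbhs_ballP[e /= e0 he].
pose z := Num.min (e / 2) pi.
have z0 : 0 < z by rewrite lt_min divr_gt0 //= pi_gt0.
have [ze zpi] : z <= e / 2 /\ z <= pi by split; rewrite /z ge_min lexx ?orbT.
have : `|f 0 - f z| < `|f 0|.
  by apply: he; rewrite /ball /= sub0r normrN gtr0_norm //; lra.
have -> : f z = 0 by apply: inside; have := pi_gt0 R; lra.
by rewrite subr0 ltxx.
Qed.

(** The difference of the integrands is the derivative of [f1 * g - f * g1], whose boundary terms
    cancel by periodicity. *)
Lemma circle_int_green f f1 f2 g g1 g2 :
  (forall x, is_derive x 1 f (f1 x)) -> (forall x, is_derive x 1 f1 (f2 x)) ->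
  (forall x, is_derive x 1 g (g1 x)) -> (forall x, is_derive x 1 g1 (g2 x)) ->
  continuous f2 -> continuous g2 ->
  f (2 * pi) = f 0 -> f1 (2 * pi) = f1 0 ->
  g (2 * pi) = g 0 -> g1 (2 * pi) = g1 0 ->
  circle_int (fun x => f2 x * g x) = circle_int (fun x => f x * g2 x).
Proof.
move=> df df1 dg dg1 cf2 cg2 pf pf1 pg pg1.
have cf := is_derive1_cont df; have cg := is_derive1_cont dg.
apply/eqP; rewrite -subr_eq0 -mulN1r -circle_intZ; last exact: contM.
rewrite -circle_intD; [|exact: contM|apply: contM; [exact: cont_cst|exact: contM]].
have dF x : is_derive x 1 (fun x => f1 x * g x + (-1) * (f x * g1 x))
    (f2 x * g x + (-1) * (f x * g2 x)).
  apply: (is_derive_eq (is_derive1D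
    (is_derive1M (df1 x) (dg x)) (is_derive1Z (-1) (is_derive1M (df x) (dg1 x))))).
  ring.
rewrite (circle_int_FTC _ dF); first by rewrite pf pf1 pg pg1 subrr.
apply: contD; first exact: contM.
by apply: contM; [exact: cont_cst|exact: contM].
Qed.

Lemma coef_derive2 f f1 f2 b m :
  (forall x, is_derive x 1 f (f1 x)) -> (forall x, is_derive x 1 f1 (f2 x)) ->
  continuous f2 -> f (2 * pi) = f 0 -> f1 (2 * pi) = f1 0 ->
  coef f2 b m = - m%:R ^+ 2 * coef f b m.
Proof.
move=> df df1 cf2 pf pf1; have cf := is_derive1_cont df.
rewrite /coef (circle_int_green df df1 (@is_derive_trig b m) (@is_derive_dtrig b m)) //.
- rewrite -circle_intZ; last exact: contM (@trig_cont _ _).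
  by apply: circle_int_ext => x; ring.
- by apply: contM; [exact: cont_cst|exact: trig_cont].
- exact: trig_2pi.
- by rewrite trig_2pi.
Qed.

(** For distinct frequencies, symmetry of the second derivative gives two different eigenvalues to
    the same product. At equal frequency, sine times cosine is the derivative of a multiple of the
    squared sine. *)
Lemma trig_orth b c m n : (b, m) != (c, n) -> coef (trig b m) c n = 0.
Proof.
have [-> {m}|mn _] := eqVneq m n; last first.
  have e : coef (fun x => - m%:R ^+ 2 * trig b m x) c n =
      - n%:R ^+ 2 * coef (trig b m) c n.
    apply: (coef_derive2 c n (@is_derive_trig b m) (@is_derive_dtrig b m)).
    - by apply: contM; [exact: cont_cst|exact: trig_cont].
    - exact: trig_2pi.
    - by rewrite trig_2pi.
  move: e; rewrite coefZ; last exact: trig_cont.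
  move/eqP; rewrite -subr_eq0 -mulrBl mulf_eq0 => /orP[|/eqP //].
  rewrite opprK addrC subr_eq0 eqrXn2 ?ler0n // eqr_nat.
  by rewrite eq_sym (negbTE mn).
rewrite xpair_eqE eqxx andbT => bc.
have -> : coef (trig b n) c n = coef (trig true n) false n.
  case: b c bc => -[] // _; apply: circle_int_ext => x; exact: mulrC.
case: n => [|n].
  rewrite -(circle_int0 R); apply: circle_int_ext => x.
  by rewrite /trig mul0r sin0 mul0r.
have n0 : n.+1%:R != 0 :> R by rewrite pnatr_eq0.
pose F x := (2 * n.+1%:R)^-1 * (trig true n.+1 x * trig true n.+1 x).
have dF x : is_derive x 1 F (trig true n.+1 x * trig false n.+1 x).
  apply: (is_derive_eq (is_derive1Z _
    (is_derive1M (is_derive_trig true n.+1 x) (is_derive_trig true n.+1 x)))).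
  by rewrite /dtrig_coef /=; field.
rewrite /coef (circle_int_FTC _ dF); first by rewrite /F !trig_2pi subrr.
exact: contM (@trig_cont _ _) (@trig_cont _ _).
Qed.

Lemma trig_norm_gt0 b m : (b, m) != (true, 0%N) -> 0 < coef (trig b m) b m.
Proof.
move=> bm; have pi0 := pi_gt0 R.
have [x x2 tx] : exists2 x : R, 0 < x < 2 * pi & trig b m x != 0.
  case: b m bm => -[|m] // _.
  - have m1 : 1 <= m.+1%:R :> R by rewrite ler1n.
    have pm : pi / (2 * m.+1%:R) <= pi :> R.
      by rewrite ler_pdivrMr ?mulr_gt0 //; nra.
    have pm0 : 0 < pi / (2 * m.+1%:R) :> R by rewrite divr_gt0 // mulr_gt0.
    set z := pi / _ in pm pm0; exists z; first by lra.
    rewrite /trig /z (_ : _ * _ = pi / 2) ?sin_pihalf ?oner_eq0 //.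
    by have : m.+1%:R != 0 :> R; [rewrite pnatr_eq0|move=> ?; field].
  - by exists pi; [lra|rewrite /trig mul0r cos0 oner_eq0].
  - have m1 : 1 <= m.+1%:R :> R by rewrite ler1n.
    have pm : pi / m.+1%:R <= pi :> R by rewrite ler_pdivrMr //; nra.
    have pm0 : 0 < pi / m.+1%:R :> R by rewrite divr_gt0.
    set z := pi / _ in pm pm0; exists z; first by lra.
    rewrite /trig /z (_ : _ * _ = pi) ?cospi ?oppr_eq0 ?oner_eq0 //.
    by have : m.+1%:R != 0 :> R; [rewrite pnatr_eq0|move=> ?; field].
apply: (@circle_int_gt0 _ _ x) => //.
- exact: contM (@trig_cont _ _) (@trig_cont _ _).
- by move=> y; rewrite -expr2 sqr_ge0.
- by rewrite -expr2 lt_def sqr_ge0 sqrf_eq0 tx.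
Qed.

Lemma coef_sum (I : Type) (r : seq I) (G : I -> R -> R) b m :
  (forall i, continuous (G i)) ->
  coef (fun x => \sum_(i <- r) G i x) b m = \sum_(i <- r) coef (G i) b m.
Proof.
move=> cG; rewrite /coef -circle_int_sum; last first.
  by move=> i; exact: contM (@trig_cont _ _).
by apply: circle_int_ext => x; rewrite mulr_suml.
Qed.

(** The difference of the two sides is orthogonal to every [trig b m], hence zero by [orth_eq0]. *)
Lemma fourier_finite f (M : nat) :
  continuous f -> (forall x, f (x + 2 * pi) = f x) ->
  (forall b m, (M <= m)%N -> coef f b m = 0) ->
  forall x, f x = \sum_(i : bool * 'I_M)
    coef f i.1 i.2 / coef (trig i.1 i.2) i.1 i.2 * trig i.1 i.2 x.
Proof.
move=> cf fper fM x.
pose G (i : bool * 'I_M) x :=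
  coef f i.1 i.2 / coef (trig i.1 i.2) i.1 i.2 * trig i.1 i.2 x.
have cG i : continuous (G i).
  by apply: contM; [exact: cont_cst|exact: trig_cont].
have cS : continuous (fun x => \sum_i G i x) by exact: cont_sum.
have cNS : continuous (fun x => (-1) * \sum_i G i x).
  by apply: contM => //; exact: cont_cst.
apply/eqP; rewrite -subr_eq0 -mulN1r; apply/eqP.
apply: (@orth_eq0 (fun x => f x + (-1) * \sum_i G i x)); last first.
  move=> y; rewrite fper; congr (_ + _ * _).
  by apply: eq_bigr => i _; rewrite /G trig_periodic.
split; first exact: contD.
move=> b m; rewrite coefD // coefZ // coef_sum //.
have cGE i : coef (G i) b m = coef f i.1 i.2 / coef (trig i.1 i.2) i.1 i.2
    * coef (trig i.1 i.2) b m.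
  by rewrite /G coefZ //; exact: trig_cont.
have [mM|Mm] := ltnP m M; last first.
  rewrite fM // big1 ?mulr0 ?addr0 // => i _; rewrite cGE [X in _ * X]trig_orth ?mulr0 //.
  by apply/negP => /eqP[_ im]; have := ltn_ord i.2; rewrite im ltnNge Mm.
rewrite (bigD1 (b, Ordinal mM)) //= big1 ?addr0; last first.
  move=> -[c i] ci; rewrite cGE [X in _ * X]trig_orth ?mulr0 //=.
(* At [(true, 0)] the denominator is 0, but [coef f true 0] vanishes as well because [trig true 0]
   does. *)
rewrite cGE /=; have [[-> ->]|bm] := eqVneq (b, m) (true, 0%N).
  rewrite /coef (_ : circle_int _ = 0) ?mul0r ?mulr0 ?addr0 //.
  rewrite -(circle_int0 R); apply: circle_int_ext => y.
  by rewrite /trig mul0r sin0 mulr0.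
by rewrite divfK ?gt_eqF ?trig_norm_gt0 // mulN1r subrr.
Qed.

(** The energy [g1 ^ 2 + s * g ^ 2] is conserved and starts at 0; as [s > 0], it controls [g]. *)
Lemma harmonic_zero_init (s : R) g g1 : 0 < s ->
  (forall x, is_derive x 1 g (g1 x)) ->
  (forall x, is_derive x 1 g1 (- s * g x)) ->
  g 0 = 0 -> g1 0 = 0 -> forall x, g x = 0.
Proof.
move=> s0 dg dg1 g0 g10 x.
have E : g1 x * g1 x + s * (g x * g x) = g1 0 * g1 0 + s * (g 0 * g 0).
  apply: (@is_derive_0_is_cst _ (fun x => g1 x * g1 x + s * (g x * g x))) => y.
  apply: (is_derive_eq (is_derive1D
    (is_derive1M (dg1 y) (dg1 y)) (is_derive1Z s (is_derive1M (dg y) (dg y))))).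
  ring.
move: E; rewrite g0 g10 !mulr0 addr0 => E.
apply/eqP; rewrite -sqrf_eq0 expr2.
have g2 : 0 <= g x * g x by rewrite -expr2 sqr_ge0.
have g12 : 0 <= g1 x * g1 x by rewrite -expr2 sqr_ge0.
by rewrite -(mulrI_eq0 _ (lregP (lt0r_neq0 s0))); apply/eqP; nra.
Qed.

(** Integrating by parts, a coefficient of frequency [m] can survive only if [s = m ^ 2]. If [s] is
    no such square, negative [s] included, [f] is therefore 0. For [s = 0] the solution is affine,
    and periodicity kills its slope; for [s > 0] the energy argument identifies it from its initial
    data. *)
Lemma periodic_harmonic (s : R) f f1 :
  (forall x, is_derive x 1 f (f1 x)) ->
  (forall x, is_derive x 1 f1 (- s * f x)) ->
  (forall x, f (x + 2 * pi) = f x) ->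
  exists n A B, (forall x, f x = A * trig false n x + B * trig true n x) /\
    (s = n%:R ^+ 2 \/ (A = 0 /\ B = 0)).
Proof.
move=> df df1 fper.
have cf := is_derive1_cont df.
have f1per x : f1 (x + 2 * pi) = f1 x.
  have D := is_derive1_shift (df (x + 2 * pi)).
  have fE : (fun t => f (t + 2 * pi)) = f by apply/funext.
  by rewrite fE in D; case: D => _ <-; case: (df x).
have f2pi : f (2 * pi) = f 0 by rewrite -{1}(add0r (2 * pi)) fper.
have f12pi : f1 (2 * pi) = f1 0 by rewrite -{1}(add0r (2 * pi)) f1per.
have [[n sn]|ns] := pselect (exists n, s = n%:R ^+ 2); last first.
  exists 0%N, 0, 0; split; last by right.
  move=> x; rewrite !mul0r addr0; apply: orth_eq0 => //; split => // b m.
  have cf2 : continuous (fun x => - s * f x) by apply: contM => //; exact: cont_cst.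
  have /eqP := coef_derive2 b m df df1 cf2 f2pi f12pi.
  rewrite coefZ // -subr_eq0 -mulrBl mulf_eq0 => /orP[|/eqP //].
  rewrite opprK addrC subr_eq0 => /eqP ms.
  by case: ns; exists m.
move: sn; case: n => [|n] sn.
  have f1c x : f1 x = f1 0.
    apply: is_derive_0_is_cst => y; have := df1 y.
    by rewrite sn expr0n /= oppr0 mul0r.
  have fc x : f x = f 0 + f1 0 * x.
    have : f x + (- f1 0) * x = f 0 + (- f1 0) * 0.
      apply: (@is_derive_0_is_cst _ (fun x => f x + (- f1 0) * x)) => y.
      apply: (is_derive_eq (is_derive1D (df y)
        (is_derive1Z _ (is_derive_id _ _)))).
      by rewrite f1c mulr1 subrr.
    by rewrite mulr0 addr0 => <-; ring.
  have f10 : f1 0 = 0.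
    have := f2pi; rewrite fc [f 0]fc => /eqP.
    rewrite mulr0 addr0 -subr_eq0 addrAC subrr add0r mulf_eq0.
    by rewrite (gt_eqF (twopi_gt0 R)) orbF => /eqP.
  exists 0%N, (f 0), 0; split; last by left.
  by move=> x; rewrite fc f10 /trig !mul0r cos0 mulr1.
have n0 : n.+1%:R != 0 :> R by rewrite pnatr_eq0.
have s0 : 0 < s by rewrite sn exprn_gt0.
exists n.+1, (f 0), (f1 0 / n.+1%:R); split; last by left.
move=> x; apply/eqP; rewrite -subr_eq0; apply/eqP.
pose A := - f 0; pose B := - (f1 0 / n.+1%:R).
pose g x := f x + (A * trig false n.+1 x + B * trig true n.+1 x).
transitivity (g x); first by rewrite /g /A /B; ring.
pose dt b x := dtrig_coef b n.+1 * trig (~~ b) n.+1 x.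
apply: (@harmonic_zero_init s g (fun x => f1 x + (A * dt false x + B * dt true x))) => //.
- move=> y; exact: (is_derive1D (df y)
    (is_derive1D (is_derive1Z A (is_derive_trig false n.+1 y))
                 (is_derive1Z B (is_derive_trig true n.+1 y)))).
- move=> y; apply: (is_derive_eq (is_derive1D (df1 y)
    (is_derive1D (is_derive1Z A (is_derive_dtrig false n.+1 y))
                 (is_derive1Z B (is_derive_dtrig true n.+1 y))))).
  by rewrite /g sn; ring.
- by rewrite /g /A /trig mulr0 cos0 sin0; ring.
- by rewrite /dt /A /B /dtrig_coef /trig /= mulr0 cos0 sin0; field.
Qed.

End fourier.

(** * Trigonometric polynomials and the Helmholtz equation *)

Section trigonometric_polynomials.
Variable R : realType.
Implicit Types (f g : R -> R).

Lemma poly_roots_seq (p : {poly R}) : p != 0 ->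
  exists rs : seq R, forall x, root p x -> x \in rs.
Proof.
move: {2}(size p) (leqnn (size p)) => n; elim: n p => [|n IH] p.
  by rewrite leqn0 size_poly_eq0 => ->.
move=> sp p0; have [[x rx]|nr] := pselect (exists x, root p x); last first.
  by exists [::] => x rx; case: nr; exists x.
have [q pq] := factor_theorem _ _ rx.
have q0 : q != 0 by apply: contra_neq p0; rewrite pq => ->; rewrite mul0r.
have [|rs rsP] := IH q _ q0.
  by move: sp; rewrite pq size_Mmonic ?monicXsubC // size_XsubC addn2.
exists (x :: rs) => y; rewrite pq rootM root_XsubC in_cons => /orP[/rsP ->|->//].
by rewrite orbT.
Qed.

Definition trig_poly f := exists P Q : {poly R},
  forall y, f y = P.[cos y] + sin y * Q.[cos y].

Lemma trig_polyD f g : trig_poly f -> trig_poly g ->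
  trig_poly (fun y => f y + g y).
Proof.
move=> [P [Q fE]] [P' [Q' gE]]; exists (P + P'), (Q + Q') => y.
by rewrite fE gE !hornerD; ring.
Qed.

Lemma trig_polyZ c f : trig_poly f -> trig_poly (fun y => c * f y).
Proof.
move=> [P [Q fE]]; exists (c *: P), (c *: Q) => y.
by rewrite fE !hornerZ; ring.
Qed.

Lemma trig_polyMcos f : trig_poly f -> trig_poly (fun y => f y * cos y).
Proof.
move=> [P [Q fE]]; exists (P * 'X), (Q * 'X) => y.
by rewrite fE !hornerMX; ring.
Qed.

Lemma trig_polyMsin f : trig_poly f -> trig_poly (fun y => f y * sin y).
Proof.
move=> [P [Q fE]]; exists ((1 - 'X^2) * Q), P => y.
rewrite fE hornerM hornerD hornerN hornerXn hornerC -sin2cos2; ring.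
Qed.

Lemma trig_poly_sum (I : Type) (r : seq I) (G : I -> R -> R) :
  (forall i, trig_poly (G i)) -> trig_poly (fun x => \sum_(i <- r) G i x).
Proof.
move=> cG; elim: r => [|i r IH].
  by exists 0, 0 => y; rewrite big_nil !horner0 mulr0 addr0.
under [X in trig_poly X]eq_fun do rewrite big_cons; exact: trig_polyD.
Qed.

Lemma trig_poly_trig b n : trig_poly (@trig R b n).
Proof.
elim: n b => [|n IH] b.
  exists (if b then 0 else 1), 0 => y; rewrite /trig mul0r sin0 cos0 horner0.
  by case: b; rewrite ?horner0 ?hornerC mulr0 addr0.
have e (y : R) : trig b n.+1 y = trig b n y * cos y +
    (if b then 1 else -1) * (trig (~~ b) n y * sin y).
  have ny : n.+1%:R * y = n%:R * y + y by rewrite -natr1; ring.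
  by rewrite /trig ny; case: b; rewrite /= ?sinD ?cosD; ring.
rewrite (funext e).
by apply: trig_polyD; [exact: trig_polyMcos|apply: trig_polyZ; exact: trig_polyMsin].
Qed.

(* Eliminating the sine, zeros of [P(cos) + sin Q(cos)] have their cosine among
   the roots of [P^2 - (1 - X^2) Q^2]; this is nonzero because the leading
   coefficients of [P^2] and [(1 - X^2) Q^2] have opposite signs. *)
Lemma trig_poly_zeros f : trig_poly f -> (exists y, f y != 0) ->
  exists zs : seq R, forall y, 0 <= y <= 2 * pi -> f y = 0 -> y \in zs.
Proof.
move=> [P [Q fE]] [y0 fy0].
pose H := P ^+ 2 - (1 - 'X^2) * Q ^+ 2.
have H0 : H != 0.
  apply: contra_neq fy0 => /eqP; rewrite subr_eq0 => /eqP PQ.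
  have /eqP : lead_coef (P ^+ 2) = lead_coef ((1 - 'X^2) * Q ^+ 2) by rewrite PQ.
  have l1 : lead_coef (1 - 'X^2 : {poly R}) = -1.
    rewrite addrC lead_coefDl ?lead_coefN ?lead_coefXn //.
    by rewrite size_polyN size_polyXn size_poly1.
  rewrite [X in _ == X]lead_coefM l1 mulN1r !expr2 !lead_coefM.
  rewrite -!expr2 -addr_eq0.
  rewrite paddr_eq0 ?sqr_ge0 // !sqrf_eq0 !lead_coef_eq0 => /andP[/eqP P0 /eqP Q0].
  by rewrite fE P0 Q0 !horner0 mulr0 addr0.
have [rs rsP] := poly_roots_seq H0.
(* On one period a cosine value is attained only at its [acos] and at the reflection of that point
   in [pi]. *)
exists (map acos rs ++ map (fun r => 2 * pi - acos r) rs) => y y02 fy.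
have Hy : root H (cos y).
  rewrite /root /H !(hornerD, hornerN, horner_exp, hornerXn, hornerX, hornerC, hornerM).
  rewrite -sin2cos2; apply/eqP.
  have Py : P.[cos y] = - (sin y * Q.[cos y]).
    by apply/eqP; rewrite -subr_eq0 opprK -fE fy.
  by rewrite Py; ring.
rewrite mem_cat; apply/orP; have [ypi|ypi] := leP y pi.
  left; apply/mapP; exists (cos y); first exact: rsP.
  by rewrite cosK // in_itv /=; lra.
right; apply/mapP; exists (cos y); first exact: rsP.
have -> : cos y = cos (2 * pi - y).
  have -> : 2 * pi - y = - y + pi *+ 2 by rewrite -[pi *+ 2]mulr_natl addrC.
  by rewrite cosD2pi cosN.
by rewrite cosK ?in_itv /=; lra.
Qed.

End trigonometric_polynomials.

(** * Separation of variables for doubly periodic solutions of [v_xx + k v_yy = - lam v] *)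

Section helmholtz.
Variable R : realType.

Lemma cont_slice1 (w : R -> R -> R) y :
  continuous (fun z : R * R => w z.1 z.2) -> continuous (w^~ y).
Proof.
move=> cw x; apply: (@continuous_comp _ _ _ (fun x => (x, y))
  (fun z : R * R => w z.1 z.2)); last exact: cw.
move=> U [[P Q] /= [Px Qy] PQU]; apply: filterS Px => z Pz.
by apply: PQU; split => //; exact: nbhs_singleton.
Qed.

Lemma rectangle_bounded (w : R -> R -> R) (a b c d : R) :
  continuous (fun z : R * R => w z.1 z.2) ->
  exists2 M : R, 0 <= M & forall x y, a <= x <= b -> c <= y <= d -> `|w x y| <= M.
Proof.
move=> cw; have [[ab cd]|n] := pselect (a <= b /\ c <= d); last first.
  by exists 0 => // x y xab ycd; case: n; lra.
have [|||z _ zP] := @compact_EVT_max (R * R)%type R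
    (fun z => `|w z.1 z.2|) (`[a, b] `*` `[c, d]).
- by exists (a, c); split; rewrite /= in_itv /= lexx.
- by apply: compact_setX; exact: segment_compact.
- apply: continuous_subspaceT => z.
  apply: (@continuous_comp _ _ _ (fun z : R * R => w z.1 z.2) Num.norm).
    exact: cw.
  exact: norm_continuous.
exists `|w z.1 z.2| => // x y xab ycd.
by apply: (zP (x, y)); rewrite inE; split; rewrite /= in_itv.
Qed.

Lemma is_derive_circle_int (w wy : R -> R -> R) (p : R -> R) (y : R) :
  continuous (fun z : R * R => w z.1 z.2) ->
  continuous (fun z : R * R => wy z.1 z.2) -> continuous p ->
  (forall x y : R, is_derive y 1 (w x) (wy x y)) ->
  is_derive y 1 (fun y => circle_int (fun x => w x y * p x))
    (circle_int (fun x => wy x y * p x)).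
Proof.
move=> cw cwy cp dw.
(* Differentiation under the integral needs domination only near [y]; on the window of radius 1 the
   constant [M1 * M2] serves. *)
have [M1 M10 M1P] := @rectangle_bounded wy 0 (2 * pi) (y - 1) (y + 1) cwy.
have [M2 M20 M2P] := continuous_bounded cp.
have dwp x (z : R) : is_derive z 1 (fun y => w x y * p x) (wy x z * p x).
  have := is_derive1M (dw x z) (is_derive_cst (p x) z 1).
  by rewrite mulr0 addr0.
pose f (y x : R) := w x y * p x.
have pE z x : partial1of2 f z x = wy x z * p x.
  by rewrite partial1of2E; case: (dwp x z).
have cM (g : R -> R) : continuous g -> lebesgue_measure.-integrable `[0, 2 * pi] (EFin \o g).
  exact: itv_integrable.
have intf z : (`](y - 1), (y + 1)[%classic : set R) z ->
    lebesgue_measure.-integrable `[0, 2 * pi] (EFin \o f z).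
  by move=> _; apply: cM; apply: contM => //; exact: cont_slice1.
have derf z x : (`](y - 1), (y + 1)[%classic : set R) z ->
    (`[0, 2 * pi]%classic : set R) x -> derivable (f^~ x) z 1.
  by move=> _ _; case: (dwp x z).
have Gub z x : (`](y - 1), (y + 1)[%classic : set R) z ->
    (`[0, 2 * pi]%classic : set R) x -> `|partial1of2 f z x| <= M1 * M2.
  rewrite /= !in_itv /= => zy x2; rewrite pE normrM.
  by apply: ler_pM => //; [apply: M1P; lra|exact: M2P].
have Iy : (`](y - 1), (y + 1)[%classic : set R) y by rewrite /= in_itv /=; lra.
pose G (_ : R) := M1 * M2.
have G0 x : 0 <= G x by rewrite mulr_ge0 // ltW.
have intG := cM _ (@cont_cst R (M1 * M2)).
apply: DeriveDef.
  exact: (@derivable_under_integral _ _ (measurableTypeR R)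
    lebesgue_measure f _ (measurable_itv _) _ _ _ Iy intf derf G G0 intG Gub).
rewrite -derive1E (@differentiation_under_integral _ _ (measurableTypeR R)
    lebesgue_measure f _ (measurable_itv _) _ _ _ Iy intf derf G G0 intG Gub).
by apply: eq_Rintegral => x _; rewrite pE.
Qed.

Variables (k lam : R) (v vx vxx vy vyy : R -> R -> R).
Hypothesis k_gt0 : 0 < k.
Hypothesis dvx : forall x y : R, is_derive x 1 (v^~ y) (vx x y).
Hypothesis dvxx : forall x y : R, is_derive x 1 (vx^~ y) (vxx x y).
Hypothesis dvy : forall x y : R, is_derive y 1 (v x) (vy x y).
Hypothesis dvyy : forall x y : R, is_derive y 1 (vy x) (vyy x y).
Hypothesis cv : continuous (fun z : R * R => v z.1 z.2).
Hypothesis cvxx : continuous (fun z : R * R => vxx z.1 z.2).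
Hypothesis cvy : continuous (fun z : R * R => vy z.1 z.2).
Hypothesis cvyy : continuous (fun z : R * R => vyy z.1 z.2).
Hypothesis vperx : forall x y, v (x + 2 * pi) y = v x y.
Hypothesis vpery : forall x y, v x (y + 2 * pi) = v x y.
Hypothesis helm : forall x y, vxx x y + k * vyy x y = - (lam * v x y).

(** Differentiating under the integral in [y] and integrating by parts in [x] shows that the
    coefficient, as a function of [y], is a periodic oscillator with constant [(lam - m ^ 2) / k].
    If that constant is [n ^ 2], then [lam] is the eigenvalue of the mode [(m, n)]. *)
Lemma coef_slice_harmonic b m : exists n A B,
  (forall y, coef (v^~ y) b m = A * trig false n y + B * trig true n y) /\
  (lam = m%:R ^+ 2 + k * n%:R ^+ 2 \/ (A = 0 /\ B = 0)).
Proof.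
have k0 : k != 0 by rewrite gt_eqF.
have [] := @periodic_harmonic R (k^-1 * (lam - m%:R ^+ 2))
    (fun y => coef (v^~ y) b m) (fun y => coef (vy^~ y) b m).
- by move=> y; apply: is_derive_circle_int => //; exact: trig_cont.
- move=> y; have e : coef (vyy^~ y) b m =
      - (k^-1 * (lam - m%:R ^+ 2)) * coef (v^~ y) b m.
    have vxper x : vx (x + 2 * pi) y = vx x y.
      have D := is_derive1_shift (dvx (x + 2 * pi) y).
      have fE : (fun t => v (t + 2 * pi) y) = v^~ y by apply/funext => t.
      by rewrite fE in D; case: D => _ <-; case: (dvx x y).
    have H := coef_derive2 b m (dvx^~ y) (dvxx^~ y) (cont_slice1 cvxx)
      (etrans (congr1 (v^~ y) (esym (add0r _))) (vperx 0 y))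
      (etrans (congr1 (vx^~ y) (esym (add0r _))) (vxper 0)).
    have e : vyy^~ y = (fun x => (- k^-1 * lam) * v x y + (- k^-1) * vxx x y).
      apply/funext => x; have h := helm x y.
      apply: (mulfI k0); rewrite mulrDr !mulrA !mulrN divff //.
      by rewrite !mulNr !mul1r; lra.
    rewrite e coefD ?coefZ ?H; try by apply: contM;
      [exact: cont_cst|exact: cont_slice1].
    + ring.
    + exact: cont_slice1.
    + exact: cont_slice1.
  by rewrite -e; apply: is_derive_circle_int => //; exact: trig_cont.
- by move=> y; apply: circle_int_ext => x; rewrite vpery.
move=> n [A [B [fE kn]]]; exists n, A, B; split=> //.
case: kn => [kn|]; [left|by right].
by rewrite -kn mulrA mulfV // mul1r addrC subrK.
Qed.

(** For each [x]-mode a single frequency [n i] in [y] is possible. The alternative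
    [A i = 0 /\ B i = 0] covers the indices below [M] that carry no mode of [lam]. *)
Lemma helmholtz_expansion : exists (M : nat) (n : bool * 'I_M -> nat)
    (A B : bool * 'I_M -> R),
  (forall x y, v x y = \sum_(i : bool * 'I_M) (A i * trig false (n i) y +
     B i * trig true (n i) y) * trig i.1 i.2 x) /\
  forall i : bool * 'I_M, lam = (i.2 : nat)%:R ^+ 2 + k * (n i)%:R ^+ 2 \/ (A i = 0 /\ B i = 0).
Proof.
(* For [m >= M] one has [m ^ 2 >= m > |lam|], so no [n] gives [lam = m ^ 2 + k * n ^ 2] and the
   coefficient vanishes. *)
pose M := (Num.trunc `|lam|).+1.
have lamM m : (M <= m)%N -> lam < m%:R ^+ 2.
  move=> Mm; have := truncnS_gt `|lam|; have := ler_norm lam.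
  have : M%:R <= m%:R :> R by rewrite ler_nat.
  have : 1 <= M%:R :> R by rewrite ler1n.
  rewrite /M; nra.
have /choice[n nP] : forall i : bool * 'I_M, exists n, exists A B,
  (forall y, coef (v^~ y) i.1 i.2 = A * trig false n y + B * trig true n y) /\
  (lam = (i.2 : nat)%:R ^+ 2 + k * n%:R ^+ 2 \/ (A = 0 /\ B = 0)).
  by move=> i; exact: coef_slice_harmonic.
have /choice[A AP] := nP; have /choice[B BP] := AP.
exists M, n, (fun i => A i / coef (@trig R i.1 i.2) i.1 i.2),
  (fun i => B i / coef (@trig R i.1 i.2) i.1 i.2); split; last first.
  move=> i; have [_ []] := BP i; first by left.
  by move=> [-> ->]; right; rewrite !mul0r.
move=> x y; rewrite (@fourier_finite R (v^~ y) M (cont_slice1 cv)) //.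
  apply: eq_bigr => i _; have [-> _] := BP i; ring.
move=> b m Mm; have [n' [A' [B' [-> []]]]] := coef_slice_harmonic b m; last first.
  by move=> [-> ->]; rewrite !mul0r addr0.
move=> lamE; have := lamM m Mm; rewrite {1}lamE.
have : 0 <= k * n'%:R ^+ 2 by rewrite mulr_ge0 ?sqr_ge0 // ltW.
by move=> ? ?; lra.
Qed.

Lemma helmholtz_antisym (s t : R) :
  (forall m n : nat, lam = m%:R ^+ 2 + k * n%:R ^+ 2 -> exists i j : nat,
     [/\ m%:R * s = i%:R * pi, n%:R * t = j%:R * pi & odd (i + j)]) ->
  forall x y, v (x + s) (y + t) = - v x y.
Proof.
move=> st x y; have [M [n [A [B [vE nP]]]]] := helmholtz_expansion.
rewrite !vE -sumrN; apply: eq_bigr => i _.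
case: (nP i) => [/st [p [q [ms nt o]]]|[-> ->]]; last by rewrite !mul0r addr0 !mul0r oppr0.
rewrite !(trig_pi_shift _ _ nt) (trig_pi_shift _ _ ms).
have sg : (-1) ^+ (p + q) = -1 :> R by rewrite -signr_odd o expr1.
by rewrite -[RHS]mulN1r -[X in _ = X * _]sg exprD; ring.
Qed.

Lemma helmholtz_lam0 : lam = 0 -> forall x y, v x y = v 0 0.
Proof.
move=> l0 x y; have [M [n [A [B [vE nP]]]]] := helmholtz_expansion.
rewrite !vE; apply: eq_bigr => i _.
case: (nP i) => [|[-> ->]]; last by rewrite !mul0r addr0 !mul0r.
rewrite l0 => /esym /eqP; rewrite paddr_eq0 ?sqr_ge0 //; last first.
  by rewrite mulr_ge0 ?sqr_ge0 // ltW.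
rewrite [k * _ == 0]mulf_eq0 (gt_eqF k_gt0) /= !sqrf_eq0 !pnatr_eq0 => /andP[/eqP -> /eqP ->].
by case: (i.1); rewrite /trig !mul0r.
Qed.

Lemma helmholtz_zeros x : (exists y, v x y != 0) ->
  exists zs : seq R, forall y, 0 <= y <= 2 * pi -> v x y = 0 -> y \in zs.
Proof.
apply: trig_poly_zeros; have [M [n [A [B [vE _]]]]] := helmholtz_expansion.
under [X in trig_poly X]eq_fun do rewrite vE.
apply: trig_poly_sum => i; under [X in trig_poly X]eq_fun do rewrite mulrC.
by apply: trig_polyZ; apply: trig_polyD; apply: trig_polyZ; exact: trig_poly_trig.
Qed.

End helmholtz.

(** * Half periods *)

Section half_periods.
Variable R : realType.

(** Translation by [(s, t)] multiplies a mode by [(-1) ^ (i + j)]; an odd sum for every mode of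
    [lam] makes it -1 on the whole eigenspace. *)
Definition half_period (k lam s t : R) := forall m n : nat,
  lam = m%:R ^+ 2 + k * n%:R ^+ 2 -> exists i j : nat,
  [/\ m%:R * s = i%:R * pi, n%:R * t = j%:R * pi & odd (i + j)].

Lemma sqr_mod4 (m : nat) : (m ^ 2 = odd m %[mod 4])%N.
Proof.
rewrite -[m in LHS]odd_double_half -mul2n; case: (odd m) => /=; lia.
Qed.

(** Everything is read off modulo 4. If 4 divides [q], then [m] and [n] are even, and halving both
    frequencies is undone by halving the shift. If [q] is odd, so is [m + n], and [(pi, pi)] works.
    If [q] is 2 modulo 4, both are odd, and [(pi, 0)] works. *)
Lemma sum_two_squares_half_period (q : nat) : (0 < q)%N ->
  exists s t : R, forall m n : nat, (m ^ 2 + n ^ 2 = q)%N -> exists i j : nat,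
  [/\ m%:R * s = i%:R * pi, n%:R * t = j%:R * pi & odd (i + j)].
Proof.
elim/ltn_ind: q => q IH q0.
have [q4|q4] := boolP (4 %| q)%N.
  have [||s [t st]] := IH (q %/ 4)%N; [lia|lia|].
  exists (s / 2), (t / 2) => m n mnq.
  have em := sqr_mod4 m; have en := sqr_mod4 n.
  have om : odd m = false by case: (odd m) (odd n) em en => -[] /= em en; lia.
  have on : odd n = false by case: (odd m) (odd n) em en => -[] /= em en; lia.
  have m2 : m = (2 * m./2)%N by rewrite -[LHS]odd_double_half om -mul2n.
  have n2 : n = (2 * n./2)%N by rewrite -[LHS]odd_double_half on -mul2n.
  have [|i [j [ms nt o]]] := st m./2 n./2.
    by rewrite -mnq {2}m2 {2}n2 !expnMn -mulnDr mulKn.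
  exists i, j; split=> //.
    by rewrite -ms {1}m2 natrM; field.
  by rewrite -nt {1}n2 natrM; field.
have [qo|qe] := boolP (odd q).
  exists pi, pi => m n mnq; exists m, n; split => //.
  by move: qo; rewrite -mnq oddD !oddX /= -oddD.
exists pi, 0 => m n mnq; exists m, 0%N; split; rewrite ?mulr0 ?mul0r ?addn0 //.
have em := sqr_mod4 m; have en := sqr_mod4 n.
by case: (odd m) em => // em; case: (odd n) en => /= en; exfalso; lia.
Qed.

(** Two representations with different [m] would give [rho ^ 2] as the quotient of [n ^ 2 - n' ^ 2]
    by [m' ^ 2 - m ^ 2]. *)
Lemma quadratic_form_injective (rho : R) (m n m' n' : nat) : 0 < rho ->
  irrational (rho ^+ 2) ->
  m%:R ^+ 2 + rho ^- 2 * n%:R ^+ 2 = m'%:R ^+ 2 + rho ^- 2 * n'%:R ^+ 2 ->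
  m = m' /\ n = n'.
Proof.
move=> r0 irr e.
have r20 : rho ^+ 2 != 0 by rewrite expf_neq0 // gt_eqF.
have e2 : rho ^+ 2 * (m'%:R ^+ 2 - m%:R ^+ 2) = n%:R ^+ 2 - n'%:R ^+ 2.
  have -> : m'%:R ^+ 2 - m%:R ^+ 2 = rho ^- 2 * (n%:R ^+ 2 - n'%:R ^+ 2).
    by rewrite mulrBr; lra.
  by rewrite mulrA divff // mul1r.
have [mm|mm] := eqVneq m m'.
  split=> //; move: e2; rewrite mm subrr mulr0 => /esym /eqP.
  by rewrite subr_eq0 eqrXn2 ?ler0n // eqr_nat => /eqP.
have mm0 : (m'%:R ^+ 2 - m%:R ^+ 2 : R) != 0.
  by rewrite subr_eq0 eqrXn2 ?ler0n // eqr_nat eq_sym.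
case: irr; exists ((n%:R ^+ 2 - n'%:R ^+ 2) / (m'%:R ^+ 2 - m%:R ^+ 2)) => //.
by rewrite fmorph_div !rmorphB !rmorphXn !rmorph_nat /= -e2 mulfK.
Qed.

Lemma half_period_exists (rho lam : R) : 0 < rho ->
  irrational (rho ^+ 2) \/ rho = 1 -> lam != 0 ->
  exists s t, half_period (rho ^- 2) lam s t.
Proof.
move=> r0 irr lam0.
have [[m0 [n0 mn0]]|none] := pselect (exists m n : nat,
    lam = m%:R ^+ 2 + rho ^- 2 * n%:R ^+ 2); last first.
  (* Without any mode the condition is vacuous. *)
  by exists 0, 0 => m n mn; case: none; exists m, n.
case: irr => [irr|rho1].
  (* With a single mode, half a wavelength in a direction in which it oscillates suffices;
     [lam != 0] excludes the mode [(0, 0)]. *)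
  case: m0 mn0 => [|m0] mn0.
    case: n0 mn0 => [|n0] mn0.
      by move: lam0; rewrite mn0 expr0n mulr0 addr0 eqxx.
    exists 0, (pi / n0.+1%:R) => m n; rewrite mn0.
    move=> /(quadratic_form_injective r0 irr)[<- <-].
    exists 0%N, 1%N; split=> //; first by rewrite mulr0 mul0r.
    by rewrite mul1r mulrC divfK // pnatr_eq0.
  exists (pi / m0.+1%:R), 0 => m n; rewrite mn0.
  move=> /(quadratic_form_injective r0 irr)[<- <-].
  exists 1%N, 0%N; split=> //; last by rewrite mulr0 mul0r.
  by rewrite mul1r mulrC divfK // pnatr_eq0.
have lamE m n : lam = m%:R ^+ 2 + rho ^- 2 * n%:R ^+ 2 ->
    (m ^ 2 + n ^ 2 = m0 ^ 2 + n0 ^ 2)%N.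
  rewrite mn0 rho1 expr1n invr1 !mul1r -!natrX -!natrD => /eqP.
  by rewrite eqr_nat => /eqP.
have [|s [t st]] := @sum_two_squares_half_period (m0 ^ 2 + n0 ^ 2).
  rewrite lt0n; apply: contra_neq lam0 => mn00.
  by rewrite mn0 rho1 expr1n invr1 mul1r -!natrX -natrD mn00.
by exists s, t => m n /lamE; exact: st.
Qed.

End half_periods.

(** * The maximum principle in a strip *)

Section strip_principle.
Variable R : realType.

(** If [d > 0], then [f1] vanishes at [x] and is positive just to its right, so [f] would exceed its
    maximum there by the mean value theorem. *)
Lemma second_derivative_at_max (f f1 : R -> R) (d x e : R) : 0 < e ->
  (forall y : R, is_derive y 1 f (f1 y)) -> is_derive x 1 f1 d ->
  (forall y, `|x - y| < e -> f y <= f x) -> d <= 0.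
Proof.
move=> e0 df df1 fmax; rewrite leNgt; apply/negP => d0.
have f1x : f1 x = 0.
  have D : is_derive x 1 f 0.
    apply: (@derive1_at_max _ f (x - e) (x + e)); first by lra.
    - by move=> t _; case: (df t).
    - by rewrite in_itv /=; lra.
    - move=> t; rewrite in_itv /= => te; apply: fmax.
      by rewrite ltr_norml; lra.
  by case: D => _ <-; case: (df x).
have [df1x df1d] := df1.
have : h^-1 *: (f1 (h *: 1 + x) - f1 x) @[h --> 0^'] --> d.
  by rewrite -df1d; exact: df1x.
move=> /cvgrPdist_lt /(_ _ d0) /nbhs_ballP[r /= r0 hr].
pose h := Num.min (r / 2) (e / 2).
have h0 : 0 < h by rewrite lt_min !divr_gt0.
have [hr2 he2] : h <= r / 2 /\ h <= e / 2.
  by split; rewrite /h ge_min lexx ?orbT.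
have f1pos t : 0 < t -> t <= h -> 0 < f1 (x + t).
  move=> t0 th.
  have tr : ball 0 r t by rewrite /ball /= sub0r normrN gtr0_norm //; lra.
  have := hr t tr (lt0r_neq0 t0).
  rewrite f1x subr0 /= [t *: 1]mulr1 [t^-1 *: _]mulrC addrC ltr_norml => /andP[_].
  by rewrite gtrDr oppr_lt0 pmulr_lgt0 ?invr_gt0 // [t + x]addrC.
have [||c] := @MVT _ f f1 x (x + h).
- by lra.
- by apply: continuous_subspaceT; exact: is_derive1_cont df.
rewrite in_itv /= => xc.
have -> : c = x + (c - x) by lra.
have := f1pos (c - x); have : f (x + h) <= f x.
  by apply: fmax; rewrite ltr_norml; lra.
by move=> fm /(_ _ _)f1c e1; have : 0 < f1 (x + (c - x)) by [apply: f1c; lra]; nra.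
Qed.

(* The quotient of [v] by [cos (kap (x - mid))], which oscillates faster, would
   have an interior maximum. *)
Lemma strip_principle (k lam kap a b : R) (v vx vxx vy vyy : R -> R -> R)
    (S : set (R * R)) :
  0 < k ->
  (forall x y : R, is_derive x 1 (v^~ y) (vx x y)) ->
  (forall x y : R, is_derive x 1 (vx^~ y) (vxx x y)) ->
  (forall x y : R, is_derive y 1 (v x) (vy x y)) ->
  (forall x y : R, is_derive y 1 (vy x) (vyy x y)) ->
  continuous (fun z : R * R => v z.1 z.2) ->
  (forall x y, v x (y + 2 * pi) = v x y) ->
  (forall x y, vxx x y + k * vyy x y = - (lam * v x y)) ->
  lam < kap ^+ 2 -> 0 < kap -> a <= b -> kap * (b - a) < pi ->
  (forall z, S z -> 0 < v z.1 z.2) ->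
  (forall z, S z -> nbhs z S) ->
  (forall z, closure S z -> v z.1 z.2 != 0 -> S z) ->
  (forall x y (j : int), S (x, y) -> S (x, y + j%:~R * (2 * pi))) ->
  (forall y, ~ S (a, y)) -> (forall y, ~ S (b, y)) ->
  forall z, S z -> ~ a <= z.1 <= b.
Proof.
move=> k0 dvx dvxx dvy dvyy cv vper helm lamk kap0 ab kapab Spos Sopen Sclosed
  Sper Sa Sb z0 Sz0 z0ab.
pose phi (x : R) := cos (kap * (x + - ((a + b) / 2))).
pose phi1 (x : R) := kap * - sin (kap * (x + - ((a + b) / 2))).
have dphi (x : R) : is_derive x 1 phi (phi1 x).
  by apply: (is_derive1_shift (f := fun x => cos (kap * x)));
    apply: is_derive1_scale; exact: is_derive_cos.
have dphi1 (x : R) : is_derive x 1 phi1 (- (kap ^+ 2) * phi x).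
  rewrite (_ : _ * _ = (kap * -1) * (kap * phi x)); last by ring.
  rewrite (_ : phi1 = fun x => (kap * -1) * sin (kap * (x + - ((a + b) / 2)))); last first.
    by apply/funext => y; rewrite /phi1; ring.
  apply: is_derive1Z.
  by apply: (is_derive1_shift (f := fun x => sin (kap * x)));
    apply: is_derive1_scale; exact: is_derive_sin.
have cphi := is_derive1_cont dphi.
(* The argument of the cosine stays within [pi / 2] of 0 because [kap * (b - a) < pi]. *)
have phi0 x : a <= x <= b -> 0 < phi x.
  by move=> xab; apply: cos_gt0_pihalf; nra.
(* One vertical period of [S] suffices, and the closure makes it compact. A maximum point still lies
   in [S]: the maximum is positive, so [v] is nonzero there. *)
pose K := (`[a, b] `*` `[0, 2 * pi]) `&` closure S.
have cK : compact K.
  apply: compact_closedI; last exact: closed_closure.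
  by apply: compact_setX; exact: segment_compact.
have SK (z : R * R) : S z -> a <= z.1 <= b -> exists j : int, K (z.1, z.2 + j%:~R * (2 * pi)).
  case: z => x y Sz xab; have [j /andP[j1 j2]] := reduce_mod y (twopi_gt0 R).
  exists j; split; last by apply: subset_closure; exact: Sper.
  by split; rewrite /= in_itv /=; [exact: xab|lra].
have vperj x y (j : int) : v x (y + j%:~R * (2 * pi)) = v x y.
  exact: periodic_int.
have [j0 Kz0] := SK _ Sz0 z0ab.
have [|||q] := @compact_EVT_max _ R (fun z => v z.1 z.2 / phi z.1) K.
- by exists (z0.1, z0.2 + j0%:~R * (2 * pi)).
- exact: cK.
- apply: continuous_in_subspaceT => z /set_mem [[/=]].
  rewrite in_itv /= => zab _ _.
  apply: cvgM; first exact: cv.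
  apply: cvgV; first by rewrite gt_eqF ?phi0.
  apply: (@continuous_comp _ _ _ (fun z : R * R => z.1) phi); first exact: cvg_fst.
  exact: cphi.
rewrite inE => -[[/=]]; rewrite !in_itv /= => qab q2 Sq qmax.
set c := v q.1 q.2 / phi q.1 in qmax.
have pq := phi0 _ qab.
have vqE : v q.1 q.2 = c * phi q.1 by rewrite /c divfK ?gt_eqF.
have c0 : 0 < c.
  apply: lt_le_trans (qmax _ (mem_set Kz0)) => /=.
  by rewrite vperj divr_gt0 ?phi0 //; exact: Spos.
have {}Sq : S q.
  by apply: Sclosed => //; rewrite vqE gt_eqF // mulr_gt0.
have qa : q.1 != a by apply/eqP => qa; apply: (Sa q.2); rewrite -qa -surjective_pairing.
have qb : q.1 != b by apply/eqP => qb; apply: (Sb q.2); rewrite -qb -surjective_pairing.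
have {}qab : a < q.1 < b by lra.
have /nbhs_ballP[e /= e0 eS] := Sopen _ Sq.
pose r := Num.min e (Num.min (q.1 - a) (b - q.1)).
have r0 : 0 < r by rewrite !lt_min e0 !subr_gt0.
have [re ra rb] : [/\ r <= e, r <= q.1 - a & r <= b - q.1].
  by split; rewrite /r !ge_min lexx ?orbT.
(* Maximality of the quotient is used as the inequality [v <= c * phi] near [q] with equality at
   [q], so no quotient has to be differentiated. *)
have lmax x y : `|q.1 - x| < r -> `|q.2 - y| < r -> v x y <= c * phi x.
  move=> xr yr; have Sxy : S (x, y).
    by apply: eS; split; rewrite /ball /=; lra.
  have xab : a <= x <= b by move: xr; rewrite ltr_norml; lra.
  have [j Kj] := SK _ Sxy xab.
  have := qmax _ (mem_set Kj); rewrite /= vperj ler_pdivrMr ?phi0 //.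
have vyy0 : vyy q.1 q.2 <= 0.
  apply: (second_derivative_at_max r0 (dvy q.1) (dvyy q.1 q.2)) => y yr.
  by rewrite vqE; apply: lmax => //; rewrite subrr normr0.
have vxx0 : vxx q.1 q.2 + - c * (- (kap ^+ 2) * phi q.1) <= 0.
  apply: (second_derivative_at_max (f := fun x => v x q.2 + (- c) * phi x) r0
    (fun x => is_derive1D (dvx x q.2) (is_derive1Z (- c) (dphi x)))
    (is_derive1D (dvxx q.1 q.2) (is_derive1Z (- c) (dphi1 q.1)))) => x xr.
  have : v x q.2 <= c * phi x by apply: lmax => //; rewrite subrr normr0.
  by rewrite vqE !mulNr subrr; lra.
(* The two second derivative tests give [- lam * v <= - kap ^ 2 * v] at [q], contrary to [v > 0] and
   [lam < kap ^ 2]. *)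
have := helm q.1 q.2; rewrite vqE.
have : 0 < (kap ^+ 2 - lam) * (c * phi q.1).
  by rewrite mulr_gt0 ?subr_gt0 // mulr_gt0.
have : k * vyy q.1 q.2 <= 0 by nra.
nra.
Qed.

End strip_principle.

(** * Topology of the torus *)

Lemma continuous_pair (T U V : topologicalType) (f : T -> U) (g : T -> V) :
  continuous f -> continuous g -> continuous (fun z => (f z, g z)).
Proof.
move=> cf cg z W [[A B] /= [Az Bz] ABW].
suff : nbhs z (fun t => W (f t, g t)) by [].
have nA : nbhs z (f @^-1` A) := cf z A Az.
have nB : nbhs z (g @^-1` B) := cg z B Bz.
by apply: filterS2 nA nB => t At Bt; apply: ABW.
Qed.

Section torus_topology.
Variable R : realType.

Lemma circle_projP (l x y : R) :
  circle_proj l x = circle_proj l y <-> exists k : int, y = x + k%:~R * l.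
Proof.
split.
  move=> /(eqmodP (period_equiv l) x y) /asboolP[k yx]; exists k.
  by rewrite -yx addrC subrK.
move=> [k ->]; apply/(eqmodP (period_equiv l) x _)/asboolP; exists k.
by rewrite addrC addKr.
Qed.

Lemma circle_proj_surj (l : R) (p : circle l) : exists x, circle_proj l x = p.
Proof. by exists (repr (p : {eq_quot (period_equiv l)}%qT)); exact: reprK. Qed.

Lemma circle_proj_continuous (l : R) : continuous (circle_proj l).
Proof. exact: pi_continuous. Qed.

(** The saturation of an open set is the union of its translates by multiples of [l], hence open. *)
Lemma circle_proj_open (l : R) (U : set R) (x : R) : nbhs x U ->
  nbhs (circle_proj l x) (circle_proj l @` U).
Proof.
move=> Ux; have [V [oV Vx] VU] : exists2 V, open_nbhs x V & V `<=` U.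
  by move: Ux; rewrite nbhsE.
apply: (@filterS _ _ _ (circle_proj l @` V)); first exact: image_subset.
apply: open_nbhs_nbhs; split; last by exists x.
rewrite /open /= /quotient_open openE => y [z Vz /circle_projP[k yz]].
have cs : continuous (fun t : R => t - k%:~R * l).
  by apply: contB; [move=> t; exact: cvg_id|exact: cont_cst].
have : nbhs (y - k%:~R * l) V.
  by rewrite yz addrK; apply: open_nbhs_nbhs.
move=> nV; have {}nV : nbhs y (fun t => V (t - k%:~R * l)) := cs y V nV.
rewrite /interior; apply: filterS nV => t Vt; exists (t - k%:~R * l) => //.
by apply/circle_projP; exists k; rewrite subrK.
Qed.

Variable rho : R.
Notation torusP := (torus_proj rho).

Lemma torus_projP (x y x' y' : R) : torusP (x, y) = torusP (x', y') <->
  exists j k : int, x' = x + j%:~R * (2 * pi) /\ y' = y + k%:~R * (2 * rho * pi).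
Proof.
split.
  by move=> [/circle_projP[j xx] /circle_projP[k yy]]; exists j, k.
move=> [j [k [xx yy]]]; congr pair; apply/circle_projP; [by exists j|by exists k].
Qed.

Lemma torus_proj_surj (p : torus rho) : exists x y, torusP (x, y) = p.
Proof.
case: p => p q; have [x <-] := circle_proj_surj p.
by have [y <-] := circle_proj_surj q; exists x, y.
Qed.

Lemma torus_proj_continuous : continuous torusP.
Proof.
apply: continuous_pair => z.
  apply: (@continuous_comp _ _ _ (fun z : R * R => z.1) (circle_proj (2 * pi))).
    exact: cvg_fst.
  exact: circle_proj_continuous.
apply: (@continuous_comp _ _ _ (fun z : R * R => z.2) (circle_proj (2 * rho * pi))).
  exact: cvg_snd.
exact: circle_proj_continuous.
Qed.

Lemma torus_proj_open (U : set (R * R)) z : nbhs z U ->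
  nbhs (torusP z) (torusP @` U).
Proof.
move=> [[A B] /= [Az Bz] ABU].
exists (circle_proj (2 * pi) @` A, circle_proj (2 * rho * pi) @` B).
  by split; exact: circle_proj_open.
by move=> [p q] [/= [a Aa <-] [b Bb <-]]; exists (a, b) => //; exact: ABU.
Qed.

Lemma continuous_torus (Z : topologicalType) (g : torus rho -> Z) :
  continuous (g \o torusP) -> continuous g.
Proof.
move=> cg p; have [x [y <-]] := torus_proj_surj p => W gW.
have /torus_proj_open := cg (x, y) _ gW.
by apply: filterS => q [z /= Wz <-].
Qed.

(** [repr] picks arbitrary lifts; [torus_shiftE] shows that the choice is immaterial. *)
Definition torus_shift (s t : R) (p : torus rho) : torus rho :=
  torusP (repr (p.1 : {eq_quot (period_equiv (2 * pi))}%qT) + s,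
          repr (p.2 : {eq_quot (period_equiv (2 * rho * pi))}%qT) + t).

Lemma torus_shiftE s t x y :
  torus_shift s t (torusP (x, y)) = torusP (x + s, y + t).
Proof.
apply/torus_projP => /=.
have [j xj] : exists j : int, x =
    repr (circle_proj (2 * pi) x : {eq_quot (period_equiv (2 * pi))}%qT) +
    j%:~R * (2 * pi).
  by apply/circle_projP; exact: reprK.
have [k yk] : exists k : int, y =
    repr (circle_proj (2 * rho * pi) y :
      {eq_quot (period_equiv (2 * rho * pi))}%qT) + k%:~R * (2 * rho * pi).
  by apply/circle_projP; exact: reprK.
by exists j, k; rewrite {1}xj {1}yk; split; ring.
Qed.

Lemma torus_shiftK s t : cancel (torus_shift s t) (torus_shift (- s) (- t)).
Proof.
move=> p; have [x [y <-]] := torus_proj_surj p.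
by rewrite !torus_shiftE !addrK.
Qed.

Lemma torus_shift_continuous s t : continuous (torus_shift s t).
Proof.
apply: continuous_torus => -[x y].
have -> : torus_shift s t \o torusP = torusP \o (fun z => (z.1 + s, z.2 + t)).
  by apply/funext => -[a b]; exact: torus_shiftE.
apply: continuous_comp; last exact: torus_proj_continuous.
move: (x, y); apply: continuous_pair => z; (apply: cvgD; last exact: cvg_cst).
  exact: cvg_fst.
exact: cvg_snd.
Qed.

Lemma class_C_cst (W : normedModType R) k (A : set (R * R)) (w : W) :
  class_C k A (fun=> w).
Proof.
elim: k w => [|k IH] w /=; first by move=> z _; exact: cvg_cst.
split=> [z _|v]; first exact: differentiable_cst.
rewrite (_ : 'D_v _ = fun=> 0); first exact: IH.
by apply/funext => z; exact: derive_cst.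
Qed.

(** The lift is a plane translation, with identity differential, and serves on all of the plane. *)
Lemma torus_shift_isometry s t (D : set (torus rho)) :
  local_isometry D (torus_shift s t).
Proof.
move=> x _; exists setT, (fun z => z + (s, t)).
have dF z : differentiable (fun z : R * R => z + (s, t)) z.
  by apply: differentiableD => //; exact: differentiable_cst.
have dFE z v : 'd (fun z : R * R => z + (s, t)) z v = v.
  rewrite -deriveE //.
  have := is_deriveD (is_derive_id z v) (is_derive_cst (s, t) z v).
  by rewrite addr0 => -[].
split=> //.
- by rewrite openE => z _; exact: filterT.
- case=> [|k] /=.
    by move=> z _; exact: differentiable_continuous.
  split=> // v; rewrite (_ : 'D_v _ = fun=> v); first exact: class_C_cst.
  by apply/funext => z; rewrite deriveE.
- by move=> [a b] _; rewrite torus_shiftE.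
- by move=> z _ v w; rewrite !dFE.
Qed.

(* Connected components: curves, images and constancy of sign *)
End torus_topology.

Section components.
Variables (R : realType) (T : topologicalType).

Lemma component_curve (A : set T) (g : R -> T) (a b s t : R) : continuous g ->
  (forall r, a <= r <= b -> A (g r)) -> a <= s <= b -> a <= t <= b ->
  connected_component A (g s) (g t).
Proof.
move=> cg gA sab tab.
apply: (@connected_component_max _ _ (g @` `[a, b])).
- by exists s; rewrite //= in_itv.
- by move=> p [r]; rewrite /= in_itv /= => rab <-; exact: gA.
- apply: connected_continuous_connected; last exact: continuous_subspaceT.
  by apply/connected_intervalP; exact: interval_is_interval.
- by exists t; rewrite //= in_itv.
Qed.

Lemma component_image (A B : set T) (g : T -> T) x : continuous g ->
  (forall z, A z -> B (g z)) -> A x ->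
  g @` connected_component A x `<=` connected_component B (g x).
Proof.
move=> cg gAB Ax; apply: connected_component_max.
- by exists x => //; exact: connected_component_refl.
- by move=> _ [z /connected_component_sub Az <-]; exact: gAB.
- apply: connected_continuous_connected; last exact: continuous_subspaceT.
  exact: component_connected.
Qed.

(** The image of a component is an interval that avoids 0. *)
Lemma component_sign (A : set T) (u : T -> R) x y : continuous u ->
  (forall z, A z -> u z != 0) -> connected_component A x y -> 0 < u x -> 0 < u y.
Proof.
move=> cu uA xy ux.
have Ax : A x.
  by apply: contrapT => /connected_component_out nA; rewrite nA in xy.
have : is_interval (u @` connected_component A x).
  apply/connected_intervalP; apply: connected_continuous_connected.
    exact: component_connected.
  exact: continuous_subspaceT.
move=> int; rewrite ltNge; apply/negP => uy.
have [|||z /connected_component_sub Az uz] := int (u y) (u x) _ _ 0.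
- by exists y.
- by exists x => //; exact: connected_component_refl.
- by rewrite uy ltW.
- by have := uA z Az; rewrite uz eqxx.
Qed.

End components.

(** * Nodal domains *)

Lemma is_derive_line (R : realType) (f : R * R -> R) (p v : R * R) (t : R) :
  derivable f (p + t *: v) v ->
  is_derive t 1 (fun s : R => f (p + s *: v)) ('D_v f (p + t *: v)).
Proof.
move=> df.
have e : (fun h : R => h^-1 *: ((fun s : R => f (p + s *: v)) (h *: 1 + t) -
      f (p + t *: v))) =
    (fun h : R => h^-1 *: (f (h *: v + (p + t *: v)) - f (p + t *: v))).
  by apply/funext => h; rewrite [h *: 1]mulr1 scalerDl addrCA.
apply: DeriveDef; first by rewrite /derivable e.
by rewrite /derive e.
Qed.

(** Used with [g] recording the position of a point among finitely many zeros. *)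
Lemma finite_image_factor (X Y : Type) (I : finType) (A : set X) (f : X -> Y)
    (g : X -> I) :
  (forall x x', A x -> A x' -> g x = g x' -> f x = f x') -> finite_set (f @` A).
Proof.
move=> fg; have [[x0 Ax0]|nA] := pselect (exists x, A x); last first.
  rewrite (_ : A = set0) ?image_set0 //.
  by apply/seteqP; split=> // x Ax; case: nA; exists x.
have /choice[r rP] : forall i, exists y, forall x, A x -> g x = i -> f x = y.
  move=> i; have [[x [Ax gx]]|n] := pselect (exists x, A x /\ g x = i).
    by exists (f x) => x' Ax' gx'; apply: fg; rewrite // gx.
  by exists (f x0) => x Ax gx; case: n; exists x.
apply: (@sub_finite_set _ _ (r @` [set` enum I])); last first.
  by apply: finite_image; exact: finite_seq.
move=> _ [x Ax <-]; exists (g x); first by rewrite /= mem_enum.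
exact/esym/rP.
Qed.

Lemma card_seq_uniq (X : eqType) (s : seq X) : uniq s ->
  ([set` s] #= `I_(size s))%card.
Proof.
move=> us; apply/card_set_bijP; exists (index^~ s); split.
- by move=> x /=; rewrite index_mem.
- by move=> x y /set_mem /= xs /set_mem /= ys; exact: index_inj.
- move=> i /= si; case: s us si => // x0 s us si.
  by exists (nth x0 (x0 :: s) i); [exact: mem_nth|exact: index_uniq].
Qed.

Section eigenfunction_lift.
Variables (R : realType) (rho : R) (u : torus rho -> R).
Hypothesis rho_gt0 : 0 < rho.
Hypothesis hu : eigenfunction u.

(* In coordinates rescaled so that both periods are [2 * pi]. *)
Definition plane_lift (x y : R) : R := u (torus_proj rho (x, rho * y)).

Let cover (z : R * R) : torus rho := torus_proj rho (z.1, rho * z.2).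

Lemma cover_per x y (j k : int) :
  cover (x + j%:~R * (2 * pi), y + k%:~R * (2 * pi)) = cover (x, y).
Proof.
apply/esym/torus_projP; exists j, k; split=> //=; ring.
Qed.

Lemma cover_surj p : exists z, cover z = p.
Proof.
have [x [y <-]] := torus_proj_surj p; exists (x, rho^-1 * y).
by rewrite /cover /= mulrA divff ?mul1r // gt_eqF.
Qed.

Lemma scale_continuous : continuous (fun z : R * R => (z.1, rho * z.2)).
Proof.
apply: continuous_pair => z; first exact: cvg_fst.
by apply: cvgM; [exact: cvg_cst|exact: cvg_snd].
Qed.

Lemma cover_continuous : continuous cover.
Proof.
move=> z; apply: (@continuous_comp _ _ _ (fun z : R * R => (z.1, rho * z.2)) (torus_proj rho)).
  exact: scale_continuous.
exact: torus_proj_continuous.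
Qed.

Lemma lift_perx x y : plane_lift (x + 2 * pi) y = plane_lift x y.
Proof.
rewrite /plane_lift -[torus_proj _ _]/(cover (x + 2 * pi, y)).
by have := cover_per x y 1 0; rewrite !mul1r mul0r addr0 => ->.
Qed.

Lemma lift_pery x y : plane_lift x (y + 2 * pi) = plane_lift x y.
Proof.
rewrite /plane_lift -[torus_proj _ _]/(cover (x, y + 2 * pi)).
by have := cover_per x y 0 1; rewrite !mul1r mul0r addr0 => ->.
Qed.

Let F := u \o torus_proj rho.

Let F_diff z : differentiable F z.
Proof. by have [_ [dF _] _] := hu; exact: dF. Qed.

Let DF_diff v z : differentiable ('D_v F) z.
Proof. by have [_ [_ dF] _] := hu; have [d _] := dF v; exact: d. Qed.

Let DDF_cont v w : continuous ('D_w ('D_v F)).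
Proof. by have [_ [_ dF] _] := hu => z; have [_ d] := dF v; exact: d. Qed.

Let e1 : R * R := (1, 0).
Let e2 : R * R := (0, 1).
Let lx x y := 'D_e1 F (x, rho * y).
Let lxx x y := 'D_e1 ('D_e1 F) (x, rho * y).
Let ly x y := rho * 'D_e2 F (x, rho * y).
Let lyy x y := rho * (rho * 'D_e2 ('D_e2 F) (x, rho * y)).

Let is_derive_x (f : R * R -> R) (x y : R) : differentiable f (x, rho * y) ->
  is_derive x 1 (fun x => f (x, rho * y)) ('D_e1 f (x, rho * y)).
Proof.
move=> df; have := @is_derive_line R f (0, rho * y) e1 x.
have e s : (0, rho * y) + s *: e1 = (s, rho * y) :> R * R.
  apply: injective_projections; rewrite /= ?scaler0 ?addr0 // add0r.
  exact: mulr1.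
rewrite e => /(_ (diff_derivable df)).
by rewrite (_ : (fun s => f _) = fun x => f (x, rho * y)) //; apply/funext => s; rewrite e.
Qed.

Let is_derive_y (f : R * R -> R) (x y : R) : differentiable f (x, rho * y) ->
  is_derive y 1 (fun y => f (x, rho * y)) (rho * 'D_e2 f (x, rho * y)).
Proof.
move=> df; have := @is_derive_line R f (x, 0) e2 (rho * y).
have e s : (x, 0) + s *: e2 = (x, s) :> R * R.
  apply: injective_projections; rewrite /= ?scaler0 ?addr0 // add0r.
  exact: mulr1.
rewrite e => /(_ (diff_derivable df)) D.
apply: (is_derive1_scale (f := fun s => f (x, s))).
by rewrite (_ : (fun s => f (x, s)) = fun s => f ((x, 0) + s *: e2)) //;
  apply/funext => s; rewrite e.
Qed.

Let cont_scaled (f : R * R -> R) : continuous f ->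
  continuous (fun z : R * R => f (z.1, rho * z.2)).
Proof.
move=> cf z; apply: (@continuous_comp _ _ _ (fun z : R * R => (z.1, rho * z.2)) f).
  exact: scale_continuous.
exact: cf.
Qed.

Let dlx (x y : R) : is_derive x 1 (plane_lift^~ y) (lx x y).
Proof. exact: is_derive_x. Qed.

Let dlxx (x y : R) : is_derive x 1 (lx^~ y) (lxx x y).
Proof. exact: is_derive_x. Qed.

Let dly (x y : R) : is_derive y 1 (plane_lift x) (ly x y).
Proof. exact: is_derive_y. Qed.

Let dlyy (x y : R) : is_derive y 1 (ly x) (lyy x y).
Proof. by apply: is_derive1Z; exact: is_derive_y. Qed.

Lemma lift_continuous : continuous (fun z : R * R => plane_lift z.1 z.2).
Proof. by apply: (cont_scaled (f := F)) => z; exact: differentiable_continuous. Qed.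

Let clxx : continuous (fun z : R * R => lxx z.1 z.2).
Proof. exact: (cont_scaled (@DDF_cont e1 e1)). Qed.

Let cly : continuous (fun z : R * R => ly z.1 z.2).
Proof.
move=> z; apply: cvgM; first exact: cvg_cst.
by apply: (cont_scaled (f := 'D_e2 F)) => t; exact: differentiable_continuous.
Qed.

Let clyy : continuous (fun z : R * R => lyy z.1 z.2).
Proof.
move=> z; apply: cvgM; first exact: cvg_cst.
apply: cvgM; first exact: cvg_cst.
exact: (cont_scaled (@DDF_cont e2 e2)).
Qed.

Let k_gt0 : 0 < rho ^- 2.
Proof. by rewrite invr_gt0 exprn_gt0. Qed.

(** Each derivative in the rescaled second variable brings a factor [rho], which the weight
    [rho ^- 2] compensates. *)
Let lift_helmholtz : exists lam, forall x y,
  lxx x y + rho ^- 2 * lyy x y = - (lam * plane_lift x y).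
Proof.
have [_ _ [lam h]] := hu; exists lam => x y; have := h (x, rho * y).
rewrite -/F /laplacian -/e1 -/e2 -[u _]/(plane_lift x y) => <-.
by rewrite opprK /lxx /lyy mulrA mulrA -expr2 mulVf ?mul1r // expf_neq0 // gt_eqF.
Qed.

Lemma eigenfunction_continuous : continuous u.
Proof. by apply: continuous_torus => z; exact: differentiable_continuous. Qed.

Lemma eigenfunction_antisym : irrational (rho ^+ 2) \/ rho = 1 ->
  ~ (exists c : R, forall p, u p = c) ->
  exists s t, forall p, u (torus_shift s t p) = - u p.
Proof.
move=> irr nc; have [lam h] := lift_helmholtz.
have lam0 : lam != 0.
  apply/eqP => lam0; apply: nc; exists (plane_lift 0 0) => p.
  have [[x y] <-] := cover_surj p.
  exact: (helmholtz_lam0 k_gt0 dlx dlxx dly dlyy lift_continuous clxx cly clyy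
    lift_perx lift_pery h lam0).
have [s [t st]] := half_period_exists rho_gt0 irr lam0.
(* The half period was found in rescaled coordinates, hence the factor [rho]. *)
exists s, (rho * t) => p; have [[x y] <-] := cover_surj p.
rewrite torus_shiftE -mulrDr.
exact: (helmholtz_antisym k_gt0 dlx dlxx dly dlyy lift_continuous clxx cly clyy
    lift_perx lift_pery h st).
Qed.

Let nz := ~` nodal_set u.

Let nzP p : nz p <-> u p != 0.
Proof. by split=> [h|/eqP h //]; apply/eqP. Qed.

(** On a ball where [u] differs from its central value by less than the absolute value of that
    value, [u] has no zero, and segments from the centre stay in the ball. *)
Lemma component_near z : u (cover z) != 0 ->
  nbhs z (fun z' => connected_component nz (cover z) (cover z')).
Proof.
move=> uz; have uz0 : 0 < `|plane_lift z.1 z.2| by rewrite normr_gt0.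
have /cvgrPdist_lt /(_ _ uz0) := @lift_continuous z.
move=> /nbhs_ballP[e /= e0 he]; apply/nbhs_ballP; exists e => //= z' [z1 z2].
pose g (t : R) := cover (z.1 + t * (z'.1 - z.1), z.2 + t * (z'.2 - z.2)).
have <- : g 0 = cover z by rewrite /g !mul0r !addr0 -surjective_pairing.
have <- : g 1 = cover z'.
  by rewrite /g !mul1r ![_ + (_ - _)]addrC !subrK -surjective_pairing.
apply: (@component_curve R _ nz g 0 1); rewrite ?lexx ?ler01 //.
  move=> t; apply: (@continuous_comp _ _ _ (fun t : R =>
    (z.1 + t * (z'.1 - z.1), z.2 + t * (z'.2 - z.2))) cover).
    by apply: continuous_pair => r; apply: cvgD; try exact: cvg_cst;
      apply: cvgM; try exact: cvg_cst; exact: cvg_id.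
  exact: cover_continuous.
move=> r r01; apply/nzP; apply/eqP => ur.
have small (a b : R) : `|a - b| < e -> `|a - (a + r * (b - a))| < e.
  move=> abe; rewrite opprD addNKr -mulrN opprB normrM.
  have := normr_ge0 (a - b); rewrite ger0_norm; last by lra.
  nra.
have := he (z.1 + r * (z'.1 - z.1), z.2 + r * (z'.2 - z.2)).
rewrite /ball /= /prod_ball /= => /(_ _).
have bb : ball z e (z.1 + r * (z'.1 - z.1), z.2 + r * (z'.2 - z.2)).
  by split; apply: small.
move=> /(_ bb); rewrite [plane_lift (_ + _) _]ur subr0 ltxx.
by [].
Qed.

(** A component missing all the lines would have a lift with points in one strip but none on its two
    sides, which [strip_principle] forbids. *)
Lemma component_meets_line : exists K : nat, forall p, u p != 0 ->
  exists j y, (j <= K)%N /\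
    connected_component nz p (cover (j%:R * (2 * pi / K%:R), y)).
Proof.
have [lam h] := lift_helmholtz.
(* Adding 1 ensures [kap ^ 2 > lam]. Below, [K > 2 * kap] makes the strip width [2 * pi / K] smaller
   than [pi / kap]. *)
pose kap := `|lam| + 1.
have kap0 : 0 < kap by rewrite ltr_wpDl.
have lamk : lam < kap ^+ 2.
  by have := ler_norm lam; have := normr_ge0 lam; rewrite /kap; nra.
pose K := (Num.trunc (2 * kap)).+1; exists K => p up.
have K0 : 0 < K%:R :> R by rewrite ltr0n.
have Kkap : 2 * kap < K%:R by exact: truncnS_gt.
have pi0 := pi_gt0 R; have twopi0 := twopi_gt0 R.
apply: contrapT => no.
have noj j y : (j <= K)%N ->
    ~ connected_component nz p (cover (j%:R * (2 * pi / K%:R), y)).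
  by move=> jK c; apply: no; exists j, y.
have [z0 z0p] := cover_surj p.
have [j0 /andP[x0 x1]] := reduce_mod z0.1 twopi0.
pose x := z0.1 + j0%:~R * (2 * pi).
have xp : cover (x, z0.2) = p.
  by have := cover_per z0.1 z0.2 j0 0; rewrite mul0r addr0 -surjective_pairing z0p.
pose w : R := 2 * pi / K%:R.
have w0 : 0 < w by rewrite divr_gt0.
have Kw : K%:R * w = 2 * pi by rewrite mulrC divfK ?gt_eqF.
pose j := Num.trunc (x / w).
have /andP[jx xj] : j%:R <= x / w < j.+1%:R.
  by apply: truncn_itv; rewrite divr_ge0 // ltW.
have {}jx : j%:R * w <= x by rewrite -ler_pdivlMr.
have {}xj : x < j.+1%:R * w by rewrite -ltr_pdivrMr.
have jK : (j < K)%N.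
  rewrite -(ltr_nat R) -(ltr_pM2r w0) Kw; exact: le_lt_trans x1.
(* Multiplying by the sign of [u p] treats positive and negative components alike. *)
pose c := Num.sg (u p).
have cup : 0 < c * u p by rewrite -normrEsg normr_gt0.
pose S z := connected_component nz p (cover z).
have Snz z : S z -> u (cover z) != 0.
  by move=> /connected_component_sub /nzP.
have Cd (f : R -> R) (d t : R) : is_derive t 1 f d -> is_derive t 1 (fun s => c * f s) (c * d).
  exact: is_derive1Z.
apply: (@strip_principle R (rho ^- 2) lam kap (j%:R * w) (j.+1%:R * w)
  (fun x y => c * plane_lift x y) (fun x y => c * lx x y) (fun x y => c * lxx x y)
  (fun x y => c * ly x y) (fun x y => c * lyy x y) S k_gt0
  (fun x y => Cd _ _ _ (dlx x y)) (fun x y => Cd _ _ _ (dlxx x y))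
  (fun x y => Cd _ _ _ (dly x y)) (fun x y => Cd _ _ _ (dlyy x y))
  _ _ _ lamk kap0 _ _ _ _ _ _ _ _ (x, z0.2)).
- by move=> z; apply: cvgM; [exact: cvg_cst|exact: lift_continuous].
- by move=> a b; rewrite lift_pery.
- by move=> a b; have := h a b; nra.
- by rewrite ler_pM2r // ler_nat.
- rewrite -mulrBl -natrB // subSnn mul1r mulrA ltr_pdivrMr //; nra.
- move=> z Sz; apply: (@component_sign R _ nz (fun q => c * u q) p) => //.
  + by move=> q; apply: cvgM; [exact: cvg_cst|exact: eigenfunction_continuous].
  + by move=> q /nzP uq; rewrite mulf_neq0 // sgr_eq0.
- move=> z Sz; have := component_near (Snz _ Sz); apply: filterS => z'.
  exact: connected_component_trans.
(* A closure point where [u] is nonzero has a neighbourhood inside its own component; this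
   neighbourhood meets [S], so the components coincide. *)
- move=> z cz; rewrite mulf_eq0 negb_or => /andP[_ vz].
  have [z' [Sz' zz']] := cz _ (component_near vz).
  by apply: connected_component_trans Sz' _; exact: connected_component_sym.
- move=> a b i; rewrite /S; have := cover_per a b 0 i.
  by rewrite mul0r addr0 => ->.
- by move=> b; apply: noj; exact: ltnW.
- by move=> b; apply: noj.
- by rewrite /S xp; apply: connected_component_refl; apply/nzP.
- by rewrite /= jx ltW.
Qed.

(** A circle on which [u] vanishes identically contributes no component. Otherwise finitely many
    zeros cut one period into arcs free of zeros. *)
Lemma line_components_finite x :
  finite_set [set connected_component nz (cover (x, y)) | y in [set y | plane_lift x y != 0]].
Proof.
have [lam h] := lift_helmholtz.
have [ex|nex] := pselect (exists y, plane_lift x y != 0); last first.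
  rewrite (_ : [set y | _] = set0) ?image_set0 //.
  by apply/seteqP; split=> // y /= ly0; case: nex; exists y.
have [zs zsP] := helmholtz_zeros k_gt0 dlx dlxx dly dlyy lift_continuous clxx
  cly clyy lift_perx lift_pery h ex.
pose A := [set y | plane_lift x y != 0 /\ 0 <= y <= 2 * pi].
apply: (@sub_finite_set _ _ [set connected_component nz (cover (x, y)) | y in A]).
  move=> _ [y /= ly0 <-]; have [j j2] := reduce_mod y (twopi_gt0 R).
  have := cover_per x y 0 j; rewrite mul0r addr0 => cE.
  exists (y + j%:~R * (2 * pi)); last by rewrite cE.
  split; last by lra.
  by move: ly0; rewrite -[plane_lift x y]/(u (cover (x, y))) -cE.
(* The component is determined by the position of [y] among the zeros. *)
apply: (@finite_image_factor _ _ _ A _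
  (fun y => [tuple of map (fun z => z < y) (in_tuple zs)])).
have same y y' : A y -> A y' -> y <= y' ->
    [tuple of map (fun z => z < y) (in_tuple zs)] =
    [tuple of map (fun z => z < y') (in_tuple zs)] ->
    connected_component nz (cover (x, y)) = connected_component nz (cover (x, y')).
  move=> [ly0 y2] [ly'0 y'2] yy' /(congr1 val) /= /eq_in_map zE.
  apply: (@same_connected_component _ nz (cover (x, y)) (cover (x, y'))).
  apply: (@component_curve R _ nz (fun t => cover (x, t)) y y'); rewrite ?lexx ?yy' //.
    move=> t; apply: (@continuous_comp _ _ _ (fun t : R => (x, t)) cover).
      by apply: continuous_pair => r; [exact: cvg_cst|exact: cvg_id].
    exact: cover_continuous.
  (* A zero between [y] and [y'] lies below [y'] but not below [y], so the two tuples would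
     differ. *)
  move=> r ry; apply/nzP/eqP => ur.
  have rzs : r \in zs by apply: zsP => //; lra.
  have := zE _ rzs; move: ry => /andP[yr]; rewrite le_eqVlt => /orP[/eqP ry'|->].
    by move: ly'0; rewrite -ry' [plane_lift x r]ur eqxx.
  by rewrite ltNge yr.
move=> y y' Ay Ay' e; have [yy'|/ltW y'y] := leP y y'; first exact: same.
by apply/esym/same.
Qed.

Lemma nodal_domains_finite : finite_set (nodal_domains u).
Proof.
have [K KP] := component_meets_line.
pose B j := [set connected_component nz (cover (j%:R * (2 * pi / K%:R), y)) |
  y in [set y | plane_lift (j%:R * (2 * pi / K%:R)) y != 0]].
apply: (@sub_finite_set _ _ (\bigcup_(j in `I_K.+1) B j)); last first.
  by apply: bigcup_finite => // j _; exact: line_components_finite.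
move=> _ [p /nzP up <-]; have [j [y [jK c]]] := KP p up.
exists j => //; exists y; last by apply/esym/same_connected_component.
by have /connected_component_sub /nzP := c.
Qed.

End eigenfunction_lift.

(** If [s] lists [P] without repetition, then [s ++ map phi s] lists [A] without repetition, which
    accounts for the factor 2. *)
Lemma pairing_enumeration (X : eqType) (A P : set X) (phi : X -> X) :
  finite_set P -> A = P `|` phi @` P -> {in P &, injective phi} ->
  (forall x, P x -> ~ P (phi x)) ->
  exists k, (A #= `I_(2 * k))%card /\
    exists D : 'I_k -> X, injective D /\ range D = P.
Proof.
move=> /finite_seqP[s0 Ps0] APP phi_inj Pphi.
pose s := undup s0; have us : uniq s by exact: undup_uniq.
have Ps x : P x <-> x \in s by rewrite Ps0 /= mem_undup.
exists (size s); split.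
  have u2 : uniq (s ++ map phi s).
    rewrite cat_uniq us map_inj_in_uniq ?us ?andbT /=.
      apply/hasPn => _ /mapP[x /Ps Px ->]; apply/negP => /Ps.
      exact: Pphi.
    by move=> x y /Ps Px /Ps Py; apply: phi_inj; exact: mem_set.
  rewrite (_ : A = [set` s ++ map phi s]).
    by have := card_seq_uniq u2; rewrite size_cat size_map mul2n addnn.
  rewrite APP; apply/seteqP; split=> x /=; rewrite mem_cat.
    case=> [/Ps -> //|[y /Ps ys <-]]; apply/orP; right.
    by apply/mapP; exists y.
  by case/orP=> [/Ps|/mapP[y /Ps Py ->]]; [left|right; exists y].
exists (tnth (in_tuple s)); split; first exact/tuple_uniqP.
apply/seteqP; split=> [_ [i _ <-]|x /Ps xs]; first by apply/Ps; exact: mem_tnth.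
by have /tnthP[i ->] : x \in in_tuple s by []; exists i.
Qed.

Lemma image_torus_shift_isometric (R : realType) (rho s t : R)
    (D : set (torus rho)) : isometric D (torus_shift s t @` D).
Proof.
exists (torus_shift s t), (torus_shift (- s) (- t)).
have K := @torus_shiftK R rho s t.
split; [| |exact: torus_shift_isometry|exact: torus_shift_isometry].
  by move=> p Dp; split; [exists p|exact: K].
by move=> _ [p Dp <-]; rewrite K.
Qed.

Unset Implicit Arguments.

Theorem theorem1 (R : realType) (rho : R) (rho_gt0 : 0 < rho)
  (rho_le1 : rho <= 1) (hrho : irrational (rho ^+ 2) \/ rho = 1)
  (u : torus rho -> R) (hu : eigenfunction u)
  (u_nonconst : ~ exists c : R, forall p, u p = c) :
  exists k : nat,
    (nodal_domains u #= `I_(2 * k)%N)%card /\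
    exists D E : 'I_k -> set (torus rho),
      [/\ injective D, injective E,
          nodal_domains u = range D `|` range E &
          forall i : 'I_k,
            [/\ isometric (D i) (E i),
                (forall p, D i p -> 0 < u p) &
                (forall p, E i p -> u p < 0)]].
Proof.
have cu := eigenfunction_continuous hu.
have [s [t anti]] := eigenfunction_antisym rho_gt0 hu hrho u_nonconst.
set sh := torus_shift s t in anti; pose sh' := @torus_shift R rho (- s) (- t).
have shK : cancel sh sh' by exact: torus_shiftK.
have shK' : cancel sh' sh.
  by have := @torus_shiftK R rho (- s) (- t); rewrite !opprK.
have anti' p : u (sh' p) = - u p by rewrite -{2}(shK' p) anti opprK.
pose nz := ~` nodal_set u.
have nzP p : nz p <-> u p != 0 by split=> [h|/eqP h //]; apply/eqP.
have nzsh p : nz p -> nz (sh p) by move=> /nzP up; apply/nzP; rewrite anti oppr_eq0.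
have nzsh' p : nz p -> nz (sh' p) by move=> /nzP up; apply/nzP; rewrite anti' oppr_eq0.
have ccsh p : nz p -> sh @` connected_component nz p = connected_component nz (sh p).
  (* One inclusion maps the component forward by [sh], the other maps it back by the inverse
     [sh']. *)
  move=> np; apply/seteqP; split.
    by apply: component_image => //; exact: torus_shift_continuous.
  move=> q cq; exists (sh' q); last exact: shK'.
  rewrite -[X in connected_component _ X](shK p).
  apply: (component_image (@torus_shift_continuous R rho (- s) (- t)) nzsh' (nzsh _ np)).
  by exists q.
have pos p q : connected_component nz p q -> 0 < u p -> 0 < u q.
  by apply: component_sign => // z /nzP.
pose shift (D : set (torus rho)) := sh @` D.
pose P := [set D | exists2 p, 0 < u p & D = connected_component nz p].
have Pnd : nodal_domains u = P `|` shift @` P.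
  apply/seteqP; split=> [_ [p np <-]|D [[p up ->]|[_ [p up ->] <-]]].
  - have /nzP := np; rewrite neq_lt => /orP[up|up]; last by left; exists p.
    (* A negative domain is the shift of the domain of [sh' p], where [u] is positive. *)
    right; exists (connected_component nz (sh' p)).
      by exists (sh' p); rewrite // anti' oppr_gt0.
    by rewrite /shift ccsh ?shK' //; exact: nzsh'.
  - by exists p => //; apply/nzP; rewrite gt_eqF.
  - have np : nz p by apply/nzP; rewrite gt_eqF.
    by rewrite /shift ccsh //; exists (sh p) => //; exact: nzsh.
have Pfin : finite_set P.
  apply: sub_finite_set (nodal_domains_finite rho_gt0 hu).
  by rewrite Pnd; exact: subsetUl.
have sh_inj : injective shift.
  move=> D D' e; apply/seteqP; split=> p Dp.
    have : shift D' (sh p) by rewrite -e; exists p.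
    by move=> [q D'q /(can_inj shK) <-].
  have : shift D (sh p) by rewrite e; exists p.
  by move=> [q D'q /(can_inj shK) <-].
have Ppos D p : P D -> D p -> 0 < u p.
  by move=> [q uq ->] /pos; exact.
have [k [card [D [Dinj DP]]]] : exists k, (nodal_domains u #= `I_(2 * k))%card /\
    exists D : 'I_k -> set (torus rho), injective D /\ range D = P.
  apply: (@pairing_enumeration _ _ P shift) => //.
    by move=> D D' _ _; exact: sh_inj.
  (* A shifted positive domain contains [sh p], where [u] is negative, so it is not in [P]. *)
  move=> _ [p up ->] Pp.
  have cp : connected_component nz p p.
    by apply: connected_component_refl; apply/nzP; rewrite gt_eqF.
  have := Ppos _ (sh p) Pp; rewrite anti oppr_gt0 => /(_ (ex_intro2 _ _ p cp erefl)).
  by move=> up'; have := lt_trans up up'; rewrite ltxx.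
have PD i : P (D i) by rewrite -DP; exists i.
exists k; split=> //; exists D, (fun i => shift (D i)); split=> //.
- by move=> i j /sh_inj /Dinj.
- rewrite Pnd -DP; congr (_ `|` _); apply/seteqP; split.
    by move=> _ [_ [i _ <-] <-]; exists i.
  by move=> _ [i _ <-]; exists (D i) => //; exists i.
- move=> i; split; first exact: image_torus_shift_isometric.
    by move=> p; exact: Ppos.
  by move=> _ [p Dp <-]; rewrite anti oppr_lt0; exact: Ppos Dp.
Qed.
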